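(* Each of the choice functions $\mathsf{C}_{\mathbb{N}}$, $\mathsf{C}_{\{0,1\}^{\mathbb{N}}}$, $\mathsf{C}_{\mathbb{N}^{\mathbb{N}}}$, $\mathsf{C}_{\mathbb{N}\times\{0,1\}^{\mathbb{N}}}$ and $\mathsf{C}_{\mathbb{R}}$ is closed under composition and idempotent.
   Context: Baire space is $\mathbb{N}^{\mathbb{N}}$, with its usual product topology and a fixed computable bijective pairing $\langle\cdot,\cdot\rangle$ on it. Computability of partial functions $F:\subseteq\mathbb{N}^{\mathbb{N}}\to\mathbb{N}^{\mathbb{N}}$ is meant via (type-2) Turing machines. A representation of a set $X$ is a surjective partial function $\delta:\subseteq\mathbb{N}^{\mathbb{N}}\to X$; $(X,\delta)$ is a represented space. $f:\subseteq X\rightrightarrows Y$ denotes a partial multi-valued function ($f(x)\neq\emptyset$ for $x\in\mathrm{dom}(f)$). The composition of $g:\subseteq X\rightrightarrows Y$ and $f:\subseteq Y\rightrightarrows Z$ has domain $\{x\in\mathrm{dom}(g):g(x)\subseteq\mathrm{dom}(f)\}$ and values $(f\circ g)(x)=\bigcup_{y\in g(x)}f(y)$. A realizer of $f:\subseteq(X,\delta_X)\rightrightarrows(Y,\delta_Y)$, written $F\vdash f$, is a single-valued $F:\subseteq\mathbb{N}^{\mathbb{N}}\to\mathbb{N}^{\mathbb{N}}$ with $\delta_Y F(p)\in f\delta_X(p)$ for all $p\in\mathrm{dom}(f\delta_X)$. Weihrauch reducibility $f\leq_{\mathrm W}g$ means: there are computable $K,H:\subseteq\mathbb{N}^{\mathbb{N}}\to\mathbb{N}^{\mathbb{N}}$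 such that $p\mapsto K\langle p,GH(p)\rangle$ is a realizer of $f$ for every $G\vdash g$; $\equiv_{\mathrm W}$ is the induced equivalence. Sierpiński space $\mathbb{S}=\{0,1\}$ has topology $\{\emptyset,\{1\},\{0,1\}\}$ and representation $\delta_{\mathbb{S}}(p)=1\iff(\exists n)\,p(n)=0$. For a represented space $(X,\delta)$, a set $U\subseteq X$ is open if its characteristic function $\chi_U:X\to\mathbb{S}$ has a continuous realizer, and closed sets are the complements of open sets. $\mathcal{A}_-(X)$ is the set of closed subsets of $X$ with the representation $\psi_-^X$: a name of $A$ is a name of $\chi_{X\setminus A}$ in the canonical function space representation $[\delta\to\delta_{\mathbb{S}}]$ (a name $nq$, $n\in\mathbb N$, $q\in\mathbb{N}^{\mathbb{N}}$, names $\chi$ iff $r\mapsto\Phi_n\langle q,r\rangle$ is a realizer of $\chi$, where $\Phi_n$ is the $n$-th computable partial function on $\mathbb{N}^{\mathbb{N}}$). Closed choice is $\mathsf{C}_X:\subseteq\mathcal{A}_-(X)\rightrightarrows X,\ A\mapsto A$ with domain the non-empty closed sets (any point of $A$ is an admissible output). Standard representations: $\delta_{\mathbb{N}}(p)=p(0)$ for $\mathbb{N}$; the (restricted) identity for $\mathbb{N}^{\mathbb{N}}$ and $\{0,1\}^{\mathbb{N}}$; canonical product representations for products (a name of $(x,y)$ is $\langle p,q\rangle$ with $p$ a name of $x$ and $q$ a name of $y$); for $\mathbb{R}$ the Cauchy representation, where $p$ names $\lim_n\overline{p(n)}$ provided $|\overline{p(i)}-\overline{p(j)}|<2^{-j}$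 for all $i>j$, with $\overline{\,\cdot\,}:\mathbb{N}\to\mathbb{Q}$ a standard numbering. The product of $f:\subseteq X\rightrightarrows Y$, $g:\subseteq W\rightrightarrows Z$ is $(f\times g)(x,w)=f(x)\times g(w)$. A multi-valued function $h$ on represented spaces is idempotent if $h\times h\equiv_{\mathrm W}h$, and closed under composition if for all multi-valued functions $f,g$ on represented spaces (of types such that $f\circ g$ makes sense), $f\leq_{\mathrm W}h$ and $g\leq_{\mathrm W}h$ imply $f\circ g\leq_{\mathrm W}h$. *)

(* Defs.v *)
From mathcomp Require Import all_boot all_order all_algebra.
From mathcomp Require Import all_classical all_reals topology normedtype sequences.

Set Implicit Arguments.
Unset Strict Implicit.
Unset Printing Implicit Defensive.

Import Order.TTheory GRing.Theory Num.Theory.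
Import numFieldNormedType.Exports.

Local Open Scope classical_set_scope.

Definition Baire : topologicalType := {ptws nat -> nat}.

Definition pfun (S T : Type) := S -> option T.

Definition pdom (S T : Type) (F : pfun S T) : set S := [set p | isSome (F p)].

(* The partial element singled out by [P].  It is only applied to predicates
   with at most one solution; otherwise some solution is chosen. *)
Definition the_unique (T : Type) (P : set T) : option T :=
  if pselect (exists x, P x) is left ex then Some (projT1 (cid ex)) else None.

Definition bpair (p q : Baire) : Baire :=
  fun n => if odd n then q n./2 else p n./2.
Definition fstB (r : Baire) : Baire := fun n => r n.*2.
Definition sndB (r : Baire) : Baire := fun n => r n.*2.+1.

(* A machine is a Turing machine in flowchart form (a finite list of numbered
   lines), with a read-only input tape, work tapes and a one-way write-only
   output tape.  Tapes are indexed by [nat]: tape 0 is the input tape, every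
   other one is a work tape.  Symbols are natural numbers and 0 is the blank;
   a given program mentions only finitely many tapes and symbols.  Input and
   output sequences are written over the letters 1 and 2, the number [k]
   being the block 1^k 2. *)

Inductive instr :=
| Halt
| MoveL of nat             (* tape *)
| MoveR of nat             (* tape *)
| Write of nat & nat       (* tape, symbol; no effect on the input tape *)
| Test of nat & nat & nat  (* tape, symbol, line to jump to if it is scanned *)
| Jump of nat              (* line *)
| Output of nat.           (* symbol *)

Definition program := seq instr.

Record config := Config {
  line : nat;
  head : nat -> int;
  work : nat -> int -> nat;
  out : seq nat }.

Definition block (k : nat) : seq nat := rcons (nseq k 1) 2.

Definition word (p : Baire) (n : nat) : seq nat :=
  flatten [seq block (p i) | i <- iota 0 n].

(* [word p i.+1] has more than [i] letters, so the default is never used. *)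
Definition input_cell (p : Baire) (z : int) : nat :=
  if z is Posz i then nth 0 (word p i.+1) i else 0.

Definition scan (p : Baire) (c : config) (t : nat) : nat :=
  if t == 0 then input_cell p (head c 0) else work c t (head c t).

Definition init_config : config := Config 0 (fun _ => 0%R) (fun _ _ => 0) [::].

Definition upd (I : eqType) (T : Type) (f : I -> T) (i : I) (v : T) : I -> T :=
  fun j => if j == i then v else f j.

(* Leaving the program has the same effect as [Halt]. *)
Definition step (M : program) (p : Baire) (c : config) : config :=
  let: Config l h w o := c in
  match nth Halt M l with
  | Halt => c
  | MoveL t => Config l.+1 (upd h t (h t - 1)%R) w o
  | MoveR t => Config l.+1 (upd h t (h t + 1)%R) w o
  | Write t a => Config l.+1 h (upd w t (upd (w t) (h t) a)) o
  | Test t a l' => Config (if scan p c t == a then l' else l.+1) h w o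
  | Jump l' => Config l' h w o
  | Output a => Config l.+1 h w (rcons o a)
  end.

Definition run (M : program) (p : Baire) (k : nat) : config :=
  iter k (step M p) init_config.

Definition computes (M : program) (p q : Baire) : Prop :=
  forall n, exists k, prefix (word q n) (out (run M p k)).

(* Goedel numbering of programs; [CodeSeq.decode] is the library's effective
   bijection from [nat] to [seq nat]. *)
Definition arg (k i : nat) : nat := nth 0 (CodeSeq.decode k) i.

Definition instr_of (k : nat) : instr :=
  let a := arg (k %/ 7) in
  match k %% 7 with
  | 0 => Halt
  | 1 => MoveL (a 0)
  | 2 => MoveR (a 0)
  | 3 => Write (a 0) (a 1)
  | 4 => Test (a 0) (a 1) (a 2)
  | 5 => Jump (a 0)
  | _ => Output (a 0)
  end.

Definition machine (n : nat) : program := map instr_of (CodeSeq.decode n).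

Lemma instr_surj i : exists k, instr_of k = i.
Proof.
pose e c s := CodeSeq.code s * 7 + c.
have H c s : (c < 7)%N -> (e c s %% 7 = c) * (e c s %/ 7 = CodeSeq.code s).
  by move=> c7; rewrite /e modnMDl modn_small // divnMDl // divn_small // addn0.
case: i => [|t|t|t a|t a l|l|a]; [exists (e 0 [::])|exists (e 1 [::t])|exists (e 2 [::t])|
 exists (e 3 [::t;a])|exists (e 4 [::t;a;l])|exists (e 5 [::l])|exists (e 6 [::a])];
 by rewrite /instr_of /arg !H // CodeSeq.codeK.
Qed.

Lemma machine_surj M : exists n, machine n = M.
Proof.
have [s <-] : exists s, map instr_of s = M.
  elim: M => [|i M [s <-]]; first by exists [::].
  by have [k <-] := instr_surj i; exists (k :: s).
by exists (CodeSeq.code s); rewrite /machine CodeSeq.codeK.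
Qed.

Definition Phi (n : nat) : pfun Baire Baire :=
  fun p => the_unique [set q | computes (machine n) p q].

Definition computable (F : pfun Baire Baire) : Prop :=
  exists n, forall p q, F p = Some q -> Phi n p = Some q.

(* The value of [odflt] outside the domain is irrelevant. *)
Definition pcontinuous (F : pfun Baire Baire) : Prop :=
  {within pdom F, continuous (fun p : Baire => odflt p (F p))}.

(* A set with a partial naming function.  Surjectivity is the separate
   predicate [represented], so that [Aminus] below can be formed without
   first proving that every closed set has a name. *)
Record space := Space { carrier :> Type; rep : pfun Baire carrier }.

Definition represented (X : space) : Prop :=
  forall x : X, exists p, rep X p = Some x.

Definition mvf (X Y : space) := X -> set Y.

Definition mdom (X Y : space) (f : mvf X Y) : set X := [set x | f x !=set0].

Definition mcomp (X Y Z : space) (f : mvf Y Z) (g : mvf X Y) : mvf X Z :=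
  fun x => [set z | g x `<=` mdom f /\ exists2 y, g x y & f y z].

Definition realizes (X Y : space) (F : pfun Baire Baire) (f : mvf X Y) : Prop :=
  forall p x, rep X p = Some x -> mdom f x ->
  exists q y, [/\ F p = Some q, rep Y q = Some y & f x y].

Definition wle (X Y W Z : space) (f : mvf X Y) (g : mvf W Z) : Prop :=
  exists K H : pfun Baire Baire,
  [/\ computable K, computable H &
      forall G : pfun Baire Baire, realizes G g ->
        realizes (fun p => obind (fun q => K (bpair p q)) (obind G (H p))) f].

Definition wequiv (X Y W Z : space) (f : mvf X Y) (g : mvf W Z) : Prop :=
  wle f g /\ wle g f.

Definition natS : space := @Space nat (fun p : Baire => Some (p 0)).

Definition baireS : space := @Space Baire (fun p : Baire => Some p).

Definition cantorS : space :=
  @Space (nat -> bool)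
    (fun p : Baire => the_unique [set x | forall n, p n = nat_of_bool (x n)]).

Definition prod_rep (X Y : space) : pfun Baire (X * Y) :=
  fun r => obind (fun x => omap (fun y => (x, y)) (rep Y (sndB r))) (rep X (fstB r)).

Definition prodS (X Y : space) : space := Space (@prod_rep X Y).

Definition rat_of (k : nat) : rat :=
  (((arg k 0)%:R - (arg k 1)%:R) / (arg k 2).+1%:R)%R.

Definition realS (R : realType) : space :=
  @Space R (fun p : Baire => the_unique [set x : R |
    (forall i j, (j < i)%N -> `|rat_of (p i) - rat_of (p j)|%R < 2 ^- j)%R /\
    (fun n => ratr (rat_of (p n)) : R) @ \oo --> x]).

Definition sierpinski : space :=
  @Space bool (fun p : Baire => Some `[< exists n, p n = 0 >]).

Definition chi (X : space) (U : set X) : mvf X sierpinski :=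
  fun x => [set `[< U x >]].

Definition is_open (X : space) (U : set X) : Prop :=
  exists F, pcontinuous F /\ realizes F (chi U).

Definition is_closed (X : space) (A : set X) : Prop := is_open (~` A).

(* A name is a sequence [n q], [n] being its first entry. *)
Definition Aminus (X : space) : space :=
  @Space {A : set X | is_closed A} (fun p : Baire => the_unique [set A |
    realizes (fun r => Phi (p 0) (bpair (fun i => p i.+1) r)) (chi (~` sval A))]).

Definition closed_choice (X : space) : mvf (Aminus X) X := fun A => sval A.

Definition mprod (X Y W Z : space) (f : mvf X Y) (g : mvf W Z) :
    mvf (prodS X W) (prodS Y Z) :=
  fun xw => f xw.1 `*` g xw.2.

Definition widempotent (X Y : space) (h : mvf X Y) : Prop :=
  wequiv (mprod h h) h.

Definition closed_under_composition (V W : space) (h : mvf V W) : Prop :=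
  forall (X Y Z : space) (f : mvf Y Z) (g : mvf X Y),
  represented X -> represented Y -> represented Z ->
  wle f h -> wle g h -> wle (mcomp f g) h.

(* Main.v *)
Require Import Defs.
From mathcomp Require Import all_boot all_order all_algebra all_classical all_reals.
From mathcomp Require Import topology normedtype sequences zify ring lra.
Import Defs.

Set Implicit Arguments.
Unset Strict Implicit.
Unset Printing Implicit Defensive.

Local Open Scope classical_set_scope.

(** Each of the five problems is characterised by computation with advice: a
problem reduces to closed choice on [X] exactly when a machine can solve it
with the help of an extra input [a], guessed from a fixed set [A] of sequences,
provided that a wrong guess is recognised as wrong after finitely many steps,
that some guess is never recognised as wrong, and that every guess which is
never recognised as wrong leads to a solution ([advised], [wle_choiceP]).  From
closed choice to advice, the guess is a name of a point of [X], and it is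
refuted when the closed set produced by the reduction rejects that point.  From
advice to closed choice, the guesses that are never refuted are the closed set.

In this form both claims are easy.  To compute a composition, guess the advice
of both parts, run the first part, feed its result to the second, and reject
as soon as one of the two rejects ([advised_comp]); a product is handled in the
same way ([advised_prod]).  This uses advice from [A * A], which is no more than
advice from [A] as soon as there is a computable map of [A] onto [A * A]
([advised_pullback]).  Such a map exists for the advice sets used here: the
natural numbers, Cantor space, Baire space, and the product of the first two.
Hence [choice_criterion].  The real line uses the advice set of the product: a
binary expansion with an integer part names every real number, and conversely
an integer part and a 0-1 sequence read as digits to the base 4 give a closed
copy of the product in the line, whose digits can be computed from any Cauchy
name, since expansions with digits 0 and 1 leave gaps between them.

All this needs machines for the functions involved, obtained from a class of
functionals [recursive], closed under substitution of functionals for the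
oracle.  On the one hand its members are computed by machines
([recursive_Phi], by compilation to register programs); on the other hand the
behaviour of an arbitrary machine, with its number as an argument, belongs to
it ([universality]).  The latter lets a machine run the machine which a name
of a closed set refers to, and it yields step-bounded simulations, total
functionals which detect a rejection even when the computation that leads to
it may diverge. *)

(** * Recursive functionals of an oracle *)

Definition env := nat -> nat.
Definition scons (n : nat) (e : env) : env := fun i => if i is j.+1 then e j else n.

Definition natrec (a : nat) (f : nat -> nat -> nat) (n : nat) : nat :=
  nat_rect (fun=> nat) a f n.

(** Functionals take an oracle [p] and an environment [e] giving values to
numbered variables.  The set [D] is a promise on the oracle: values are
prescribed, and searches have to end, for oracles in [D] only, so that [D]
carries the domains of partial functions while all functionals stay total.  A
renaming of variables may be arbitrary because an expression mentions finitely
many of them. *)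
Inductive recursive (D : set Baire) : (Baire -> env -> nat) -> Prop :=
| rec_ext F G : recursive D F -> (forall p e, D p -> G p e = F p e) ->
    recursive D G
| rec_zero : recursive D (fun _ _ => 0)
| rec_succ0 : recursive D (fun _ e => (e 0).+1)
| rec_var i : recursive D (fun _ e => e i)
| rec_oracle0 : recursive D (fun p e => p (e 0))
| rec_let F G : recursive D F -> recursive D G ->
    recursive D (fun p e => F p (scons (G p e) e))
| rec_rename F xi : recursive D F ->
    recursive D (fun p e => F p (fun i => e (xi i)))
| rec_natrec0 F G : recursive D F -> recursive D G ->
    recursive D (fun p e =>
      natrec (F p e) (fun n r => G p (scons n (scons r e))) (e 0))
| rec_mu F G : recursive D F ->
    (forall p e, D p -> F p (scons (G p e) e) = 0 /\
       forall j, j < G p e -> F p (scons j e) != 0) ->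
    recursive D G.

Section Closure.
Variable D : set Baire.
Implicit Types A B C N : Baire -> env -> nat.

(** In the lemmas below the environment is built so that [e 0] is the variable
bound last; an open subterm under a binder becomes, by conversion, the same
term with its variables shifted. *)
Lemma rec_app1 f A : recursive D (fun p e => f p (e 0)) -> recursive D A ->
  recursive D (fun p e => f p (A p e)).
Proof. by move=> hf hA; have := rec_let hf hA. Qed.

Lemma rec_app2 f A B : recursive D (fun p e => f p (e 0) (e 1)) ->
  recursive D A -> recursive D B ->
  recursive D (fun p e => f p (A p e) (B p e)).
Proof.
move=> hf hA hB.
have h3 := rec_let hf (rec_rename S hA).
exact: (rec_let h3 hB).
Qed.

Lemma rec_app3 f A B C : recursive D (fun p e => f p (e 0) (e 1) (e 2)) ->
  recursive D A -> recursive D B -> recursive D C ->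
  recursive D (fun p e => f p (A p e) (B p e) (C p e)).
Proof.
move=> hf hA hB hC.
have h3 := rec_let hf (rec_rename (fun i => i.+2) hA).
have h4 := rec_let h3 (rec_rename S hB).
exact: (rec_let h4 hC).
Qed.

Lemma rec_app4 f A B C E : recursive D (fun p e => f p (e 0) (e 1) (e 2) (e 3)) ->
  recursive D A -> recursive D B -> recursive D C -> recursive D E ->
  recursive D (fun p e => f p (A p e) (B p e) (C p e) (E p e)).
Proof.
move=> hf hA hB hC hE.
have h3 := rec_let hf (rec_rename (fun i => i.+3) hA).
have h4 := rec_let h3 (rec_rename (fun i => i.+2) hB).
have h5 := rec_let h4 (rec_rename S hC).
exact: (rec_let h5 hE).
Qed.

Lemma rec_app5 f A B C E F : recursive D (fun p e => f p (e 0) (e 1) (e 2) (e 3) (e 4)) ->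
  recursive D A -> recursive D B -> recursive D C -> recursive D E -> recursive D F ->
  recursive D (fun p e => f p (A p e) (B p e) (C p e) (E p e) (F p e)).
Proof.
move=> hf hA hB hC hE hF.
have h3 := rec_let hf (rec_rename (fun i => i.+4) hA).
have h4 := rec_let h3 (rec_rename (fun i => i.+3) hB).
have h5 := rec_let h4 (rec_rename (fun i => i.+2) hC).
have h6 := rec_let h5 (rec_rename S hE).
exact: (rec_let h6 hF).
Qed.

Lemma rec_succ A : recursive D A -> recursive D (fun p e => (A p e).+1).
Proof. exact: (rec_app1 (f := fun _ x => x.+1) (rec_succ0 D)). Qed.

Lemma rec_const c : recursive D (fun _ _ => c).
Proof. by elim: c => [|c]; [exact: rec_zero|exact: rec_succ]. Qed.

Lemma rec_oracle A : recursive D A -> recursive D (fun p e => p (A p e)).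
Proof. exact: (rec_app1 (f := fun p x => p x) (rec_oracle0 D)). Qed.

Lemma rec_natrec A G N : recursive D A -> recursive D N ->
  recursive D (fun p e => G p (fun i => e i.+2) (e 0) (e 1)) ->
  recursive D (fun p e => natrec (A p e) (G p e) (N p e)).
Proof.
move=> hA hN hG.
have hG' := rec_rename (scons 0 (scons 1 (fun i => i.+3))) hG.
have h := rec_natrec0 (rec_rename S hA) hG'.
exact: (rec_let h hN).
Qed.

Lemma rec_if c A B : recursive D (fun p e => nat_of_bool (c p e)) ->
  recursive D A -> recursive D B ->
  recursive D (fun p e => if c p e then A p e else B p e).
Proof.
move=> hc hA hB.
apply: (@rec_ext _ (fun p e => natrec (B p e) (fun _ _ => A p e) (c p e))).
  by apply: rec_natrec => //; exact: (rec_rename (fun i => i.+2) hA).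
by move=> p e _; case: (c p e).
Qed.

Lemma rec_add A B : recursive D A -> recursive D B ->
  recursive D (fun p e => A p e + B p e).
Proof.
move=> hA hB.
apply: (@rec_ext _ (fun p e => natrec (A p e) (fun _ r => r.+1) (B p e))).
  by apply: rec_natrec => //; exact: rec_succ (rec_var _ 1).
by move=> p e _; elim: (B p e) => [|n /= <-]; rewrite ?addn0 ?addnS.
Qed.

Lemma rec_mul A B : recursive D A -> recursive D B ->
  recursive D (fun p e => A p e * B p e).
Proof.
move=> hA hB.
apply: (@rec_ext _ (fun p e => natrec 0 (fun _ r => r + A p e) (B p e))).
  apply: rec_natrec => //; first exact: rec_zero.
  by apply: rec_add; [exact: rec_var|exact: (rec_rename (fun i => i.+2) hA)].
by move=> p e _; elim: (B p e) => [|n /= <-]; rewrite ?muln0 // mulnS addnC.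
Qed.

Lemma rec_pred A : recursive D A -> recursive D (fun p e => (A p e).-1).
Proof.
move=> hA.
apply: (@rec_ext _ (fun p e => natrec 0 (fun n _ => n) (A p e))).
  by apply: rec_natrec => //; [exact: rec_zero|exact: rec_var].
by move=> p e _; case: (A p e).
Qed.

Lemma rec_sub A B : recursive D A -> recursive D B ->
  recursive D (fun p e => A p e - B p e).
Proof.
move=> hA hB.
apply: (@rec_ext _ (fun p e => natrec (A p e) (fun _ r => r.-1) (B p e))).
  by apply: rec_natrec => //; exact: rec_pred (rec_var _ 1).
by move=> p e _; elim: (B p e) => [|n /= <-]; rewrite ?subn0 ?subnS.
Qed.

Lemma rec_exp b A : recursive D A -> recursive D (fun p e => b ^ A p e).
Proof.
move=> hA.
apply: (@rec_ext _ (fun p e => natrec 1 (fun _ r => b * r) (A p e))).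
  apply: rec_natrec => //; first exact: rec_const.
  by apply: rec_mul; [exact: rec_const|exact: rec_var].
by move=> p e _; elim: (A p e) => [|n /= <-]; rewrite ?expnS.
Qed.

Lemma rec_not c : recursive D (fun p e => nat_of_bool (c p e)) ->
  recursive D (fun p e => nat_of_bool (~~ c p e)).
Proof.
move=> hc; apply: (rec_ext (rec_sub (rec_const 1) hc)) => p e _.
by case: (c p e).
Qed.

Lemma rec_and b c : recursive D (fun p e => nat_of_bool (b p e)) ->
  recursive D (fun p e => nat_of_bool (c p e)) ->
  recursive D (fun p e => nat_of_bool (b p e && c p e)).
Proof.
move=> hb hc; apply: (rec_ext (rec_mul hb hc)) => p e _.
by case: (b p e) (c p e) => [] [].
Qed.

Lemma rec_leq A B : recursive D A -> recursive D B ->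
  recursive D (fun p e => nat_of_bool (A p e <= B p e)).
Proof.
move=> hA hB.
apply: (rec_ext (rec_sub (rec_const 1) (rec_sub hA hB))) => p e _ /=.
by rewrite /leq; case: (_ - _ ) => // n; rewrite subSS sub0n.
Qed.

Lemma rec_eq A B : recursive D A -> recursive D B ->
  recursive D (fun p e => nat_of_bool (A p e == B p e)).
Proof.
move=> hA hB.
apply: (rec_ext (rec_and (rec_leq hA hB) (rec_leq hB hA))) => p e _ /=.
by rewrite eqn_leq.
Qed.

Lemma rec_sum N G : recursive D N ->
  recursive D (fun p e => G p (fun i => e i.+1) (e 0)) ->
  recursive D (fun p e => \sum_(0 <= j < N p e) G p e j).
Proof.
move=> hN hG.
apply: (@rec_ext _ (fun p e => natrec 0 (fun j r => r + G p e j) (N p e))).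
  apply: rec_natrec => //; first exact: rec_zero.
  apply: rec_add; first exact: rec_var.
  exact: (rec_rename (scons 0 (fun i => i.+2)) hG).
move=> p e _; elim: (N p e) => [|n /= <-]; first by rewrite big_geq.
by rewrite big_nat_recr.
Qed.

(** For positive [B], the quotient is the number of positive multiples of [B]
up to [A]. *)
Lemma rec_div A B : recursive D A -> recursive D B ->
  recursive D (fun p e => A p e %/ B p e).
Proof.
move=> hA hB.
apply: (@rec_ext _ (fun p e => if B p e == 0 then 0 else
   \sum_(0 <= j < A p e) (j.+1 * B p e <= A p e))).
  apply: rec_if; [by apply: rec_eq => //; exact: rec_const|exact: rec_const|].
  apply: rec_sum => //; apply: rec_leq; last exact: (rec_rename S hA).
  apply: rec_mul; last exact: (rec_rename S hB).
  exact: (rec_succ (rec_var _ 0)).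
move=> p e _; case: eqP => [->|/eqP]; first by rewrite divn0.
rewrite -lt0n; move: (B p e) (A p e) => d m d0.
rewrite big_mkord; under eq_bigr => j _ do rewrite -leq_divRL //.
have := leq_div m d; move: (m %/ d) => q qm.
rewrite -(subnKC qm) big_split_ord /= (eq_bigr (fun=> 1)); last first.
  by move=> i _; rewrite ltn_ord.
rewrite sum1_card card_ord [X in _ + X]big1 ?addn0 // => i _.
by rewrite ltnNge leq_addr.
Qed.

Lemma rec_mod A B : recursive D A -> recursive D B ->
  recursive D (fun p e => A p e %% B p e).
Proof.
move=> hA hB.
apply: (rec_ext (rec_sub hA (rec_mul (rec_div hA hB) hB))) => p e _.
by rewrite [X in _ = X - _](divn_eq (A p e) (B p e)) addKn.
Qed.

Lemma rec_odd A : recursive D A -> recursive D (fun p e => nat_of_bool (odd (A p e))).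
Proof.
move=> hA; apply: (rec_ext (rec_mod hA (rec_const 2))) => p e _.
by rewrite modn2.
Qed.

Lemma rec_half A : recursive D A -> recursive D (fun p e => (A p e)./2).
Proof.
move=> hA; apply: (rec_ext (rec_div hA (rec_const 2))) => p e _.
by rewrite divn2.
Qed.

Lemma rec_double A : recursive D A -> recursive D (fun p e => (A p e).*2).
Proof.
by move=> hA; apply: (rec_ext (rec_add hA hA)) => p e _; rewrite addnn.
Qed.

Lemma rec_logn2 A : recursive D A -> recursive D (fun p e => logn 2 (A p e)).
Proof.
move=> hA.
apply: (@rec_ext _ (fun p e => \sum_(0 <= j < (A p e).-1) (A p e %% 2 ^ j.+1 == 0))).
  apply: rec_sum; first exact: rec_pred.
  apply: rec_eq; last exact: rec_const.
  apply: rec_mod; first exact: (rec_rename S hA).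
  by apply: rec_exp; apply: rec_succ; exact: rec_var.
move=> p e _; case: (A p e) => [|n]; first by rewrite big_geq.
by rewrite logn_count_dvd // big_add1.
Qed.
End Closure.

(** * Codes of finite sequences *)

(** [CodeSeq.code] sends [x :: s] to [2 ^ x] times an odd number, so that head
and tail are read off from the 2-adic valuation. *)
Definition ccons (x k : nat) := 2 ^ x * k.*2.+1.
Definition ctail (k : nat) := (k %/ 2 ^ logn 2 k)./2.

Lemma code_cons x s : CodeSeq.code (x :: s) = ccons x (CodeSeq.code s).
Proof. by []. Qed.

Lemma logn_ccons x k : logn 2 (ccons x k) = x.
Proof.
rewrite /ccons lognM ?expn_gt0 // pfactorK // logn_coprime ?addn0 //.
by rewrite coprime2n /= odd_double.
Qed.

Lemma ctail_ccons x k : ctail (ccons x k) = k.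
Proof.
by rewrite /ctail logn_ccons /ccons mulKn ?expn_gt0 //= uphalf_double.
Qed.

Lemma arg_code s i : arg (CodeSeq.code s) i = nth 0 s i.
Proof. by rewrite /arg CodeSeq.codeK. Qed.

Lemma arg_ccons0 x k : arg (ccons x k) 0 = x.
Proof. by rewrite -[k]CodeSeq.decodeK -code_cons arg_code. Qed.

Lemma arg_cconsS x k i : arg (ccons x k) i.+1 = arg k i.
Proof. by rewrite -[k in LHS]CodeSeq.decodeK -code_cons arg_code. Qed.

Lemma argE k i : arg k i = logn 2 (iter i ctail k).
Proof.
rewrite -[k]CodeSeq.decodeK arg_code.
elim: (CodeSeq.decode k) i => [|x s IH] [|i] //.
- by rewrite nth_nil; elim: i => // i IH; rewrite iterSr -IH.
- by rewrite code_cons /= -/(code_cons _ _) logn_ccons.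
by rewrite iterSr code_cons ctail_ccons -IH.
Qed.

Section ClosureCodes.
Variable D : set Baire.
Implicit Types A B C N : Baire -> env -> nat.

Lemma rec_ccons A B : recursive D A -> recursive D B ->
  recursive D (fun p e => ccons (A p e) (B p e)).
Proof.
move=> hA hB; apply: rec_mul; first exact: rec_exp.
by apply: rec_succ; exact: rec_double.
Qed.

Lemma rec_arg A B : recursive D A -> recursive D B ->
  recursive D (fun p e => arg (A p e) (B p e)).
Proof.
move=> hA hB.
apply: (@rec_ext _ (fun p e => logn 2 (natrec (A p e) (fun _ k => ctail k) (B p e)))).
  apply: rec_logn2; apply: rec_natrec => //; apply: rec_half; apply: rec_div.
    exact: rec_var.
  by apply: rec_exp; apply: rec_logn2; exact: rec_var.
by move=> p e _; rewrite argE; congr logn.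
Qed.

End ClosureCodes.

Lemma rec_sub_dom (D E : set Baire) F : D `<=` E -> recursive E F -> recursive D F.
Proof.
move=> DE; elim=> {F}.
- by move=> F G _ hF FG; apply: (rec_ext hF) => p e /DE; exact: FG.
- exact: rec_zero.
- exact: rec_succ0.
- exact: rec_var.
- exact: rec_oracle0.
- by move=> F G _ hF _ hG; exact: rec_let.
- by move=> F xi _ hF; exact: rec_rename.
- by move=> F G _ hF _ hG; exact: rec_natrec0.
- by move=> F G _ hF FG; apply: (rec_mu hF) => p e /DE; exact: FG.
Qed.

Lemma rec_total D F : recursive setT F -> recursive D F.
Proof. exact: rec_sub_dom. Qed.

(** Substitution for the oracle: this is what makes composition of computable
partial functions a formality. *)
Lemma rec_subst (D E : set Baire) (O : Baire -> Baire) F :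
  recursive D (fun p e => O p (e 0)) -> (forall p, D p -> E (O p)) ->
  recursive E F -> recursive D (fun p e => F (O p) e).
Proof.
move=> hO DE; elim=> {F}.
- by move=> F G _ hF FG; apply: (rec_ext hF) => p e /DE; exact: FG.
- exact: rec_zero.
- exact: rec_succ0.
- exact: rec_var.
- exact: hO.
- by move=> F G _ hF _ hG; exact: (rec_let hF hG).
- by move=> F xi _ hF; exact: (rec_rename xi hF).
- by move=> F G _ hF _ hG; exact: (rec_natrec0 hF hG).
- by move=> F G _ hF FG; apply: (rec_mu hF) => p e /DE; exact: FG.
Qed.

(** The order matters: a power of a successor unfolds to a product, and a
boolean seen as a number unfolds to a conditional. *)
Ltac rec_step := cbv beta; first
  [ exact: rec_var | exact: rec_const | apply: rec_succ | apply: rec_oracle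
  | apply: rec_not | apply: rec_and | apply: rec_eq | apply: rec_leq | apply: rec_odd
  | apply: rec_sum | apply: rec_exp | apply: rec_add | apply: rec_sub | apply: rec_mul
  | apply: rec_div | apply: rec_mod | apply: rec_half | apply: rec_double
  | apply: rec_ccons | apply: rec_arg | apply: rec_natrec | apply: rec_pred | apply: rec_if ].
Ltac rec := repeat rec_step.

(** * Structured machine programs *)

Inductive prog :=
| Atom of instr
| Seq of prog & prog
| Until of nat & nat & prog.

Fixpoint psize (P : prog) : nat :=
  match P with
  | Atom _ => 1
  | Seq P Q => psize P + psize Q
  | Until _ _ P => (psize P).+2
  end.

Fixpoint compile (P : prog) (l : nat) : program :=
  match P with
  | Atom i => [:: i]
  | Seq P Q => compile P l ++ compile Q (l + psize P)
  | Until t a P => Test t a (l + (psize P).+2) :: rcons (compile P l.+1) (Jump l)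
  end.

Lemma size_compile P l : size (compile P l) = psize P.
Proof.
elim: P l => [i|P IHP Q IHQ|t a P IH] l //=; first by rewrite size_cat IHP IHQ.
by rewrite size_rcons IH.
Qed.

Definition state : Type := (nat -> int) * (nat -> int -> nat) * seq nat.
Definition at_line (l : nat) (st : state) : config :=
  Config l st.1.1 st.1.2 st.2.

Definition scanned p (st : state) t := scan p (at_line 0 st) t.

Definition straight (i : instr) : bool :=
  match i with MoveL _ | MoveR _ | Write _ _ | Output _ => true | _ => false end.

Definition effect (i : instr) (st : state) : state :=
  let: (h, w, o) := st in
  match i with
  | MoveL t => (upd h t (h t - 1)%R, w, o)
  | MoveR t => (upd h t (h t + 1)%R, w, o)
  | Write t a => (h, upd w t (upd (w t) (h t) a), o)
  | Output a => (h, w, rcons o a)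
  | _ => st
  end.

Inductive exec (p : Baire) : prog -> state -> state -> Prop :=
| exec_atom i st : straight i -> exec p (Atom i) st (effect i st)
| exec_seq P Q st st1 st2 : exec p P st st1 -> exec p Q st1 st2 ->
    exec p (Seq P Q) st st2
| exec_stop t a P st : scanned p st t = a -> exec p (Until t a P) st st
| exec_loop t a P st st1 st2 : scanned p st t != a -> exec p P st st1 ->
    exec p (Until t a P) st1 st2 -> exec p (Until t a P) st st2.

Definition located (M : program) (P : prog) (l : nat) :=
  forall i, i < psize P -> nth Halt M (l + i) = nth Halt (compile P l) i.

Lemma exec_step M p i l st : straight i -> nth Halt M l = i ->
  step M p (at_line l st) = at_line l.+1 (effect i st).
Proof. by case: st => [[h w] o]; rewrite /step /at_line /= => + ->; case: i. Qed.

Lemma step_test M p t a l' l st : nth Halt M l = Test t a l' ->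
  step M p (at_line l st) = at_line (if scanned p st t == a then l' else l.+1) st.
Proof. by case: st => [[h w] o]; rewrite /step /at_line /= => ->. Qed.

Lemma step_jump M p l' l st : nth Halt M l = Jump l' ->
  step M p (at_line l st) = at_line l' st.
Proof. by case: st => [[h w] o]; rewrite /step /at_line /= => ->. Qed.

(** Programs end by falling through to the line after their code. *)
Lemma exec_compile p P st st' : exec p P st st' ->
  forall M l, located M P l ->
  exists k, iter k (step M p) (at_line l st) = at_line (l + psize P) st'.
Proof.
elim=> {P st st'}.
- move=> i st si M l loc; exists 1; rewrite addn1.
  by apply: exec_step => //; have := loc 0 isT; rewrite addn0.
- move=> P Q st st1 st2 _ IHP _ IHQ M l loc.
  have [i iP|k1 E1] := IHP M l.
    by rewrite loc /= ?ltn_addr // nth_cat size_compile iP.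
  have [i iQ|k2 E2] := IHQ M (l + psize P).
    by rewrite -addnA loc /= ?ltn_add2l // nth_cat size_compile ltnNge leq_addr addKn.
  by exists (k2 + k1); rewrite iterD E1 E2 /= addnA.
- move=> t a P st sc M l loc; exists 1.
  have /step_test E : nth Halt M l = Test t a (l + (psize P).+2).
    by rewrite -[in LHS](addn0 l) loc.
  by apply: etrans (E _ _) _; rewrite sc eqxx.
- move=> t a P st st1 st2 sc _ IHP _ IHW M l loc.
  have [i iP|k1 E1] := IHP M l.+1.
    rewrite addSn -addnS loc /=; last by rewrite !ltnS ltnW.
    by rewrite nth_rcons size_compile iP.
  have [k2 E2] := IHW M l loc.
  exists (k2 + (1 + (k1 + 1))); rewrite !iterD -E2; congr (iter k2).
  change (step M p (iter k1 (step M p) (step M p (at_line l st))) = at_line l st1).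
  have /step_test -> : nth Halt M l = Test t a (l + (psize P).+2).
    by rewrite -[in LHS](addn0 l) loc.
  rewrite (negbTE sc) E1; apply: step_jump.
  have := loc (psize P).+1 (leqnn _); rewrite addnS -addSn => -> /=.
  by rewrite nth_rcons size_compile ltnn eqxx.
Qed.

(** * The input tape *)

Definition block_start (p : nat -> nat) (i : nat) := \sum_(0 <= j < i) (p j).+1.

Lemma wordS p n : word p n.+1 = word p n ++ block (p n).
Proof. by rewrite /word -addn1 iotaD map_cat flatten_cat /= cats0. Qed.

Lemma size_block k : size (block k) = k.+1.
Proof. by rewrite size_rcons size_nseq. Qed.

Lemma block_startS p i : block_start p i.+1 = block_start p i + (p i).+1.
Proof. by rewrite /block_start big_nat_recr. Qed.

Lemma size_word p n : size (word p n) = block_start p n.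
Proof.
elim: n => [|n IH]; first by rewrite /block_start big_geq.
by rewrite wordS size_cat IH size_block block_startS.
Qed.

Lemma leq_block_start p i : i <= block_start p i.
Proof.
elim: i => // i IH; rewrite block_startS addnS ltnS.
by apply: leq_trans IH _; exact: leq_addr.
Qed.

Lemma prefix_word p m n : m <= n -> prefix (word p m) (word p n).
Proof.
move=> mn; rewrite -(subnKC mn); elim: (n - m) => [|k IH].
  by rewrite addn0 prefix_refl.
by rewrite addnS wordS; apply: prefix_trans IH _; exact: prefix_prefix.
Qed.

Lemma nth_prefix (T : eqType) (x0 : T) s1 s2 i : prefix s1 s2 -> i < size s1 ->
  nth x0 s2 i = nth x0 s1 i.
Proof. by case/prefixP => s -> ?; rewrite nth_cat ifT. Qed.

Lemma input_cellE p i o : o <= p i ->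
  input_cell p (Posz (block_start p i + o)) = if o < p i then 1 else 2.
Proof.
move=> op; rewrite /input_cell.
have io : i <= block_start p i + o.
  by apply: leq_trans (leq_block_start p i) _; exact: leq_addr.
rewrite (@nth_prefix _ _ (word p i.+1)); last 2 first.
- exact: prefix_word.
- by rewrite size_word block_startS ltn_add2l ltnS.
rewrite wordS nth_cat size_word ltnNge leq_addr /= addKn /block nth_rcons size_nseq.
by rewrite nth_nseq; case: ltngtP op => // -> .
Qed.

Lemma input_cell_pos p n : input_cell p (Posz n) != 0.
Proof.
rewrite /input_cell.
have /(mem_nth 0) : n < size (word p n.+1) by rewrite size_word leq_block_start.
move: (nth _ _ _) => x /flattenP [s /mapP[i _ ->]].
by rewrite /block mem_rcons inE mem_nseq => /orP[/eqP->|/andP[_ /eqP->]].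
Qed.

(** * Register programs *)

Definition store := nat -> nat.

(** Register [r] is the head position on work tape [r.+1], where a single mark
on cell 0 makes zero recognisable.  Only the first [N] tapes carry the mark,
as it has to be written at the start.  The input head may be anywhere on the
input word. *)
Definition holds (N : nat) (s : store) (o : seq nat) (st : state) : Prop :=
  [/\ forall r, r < N -> st.1.1 r.+1 = Posz (s r) /\
        (forall z, st.1.2 r.+1 z = nat_of_bool (z == 0%R)),
      exists n, st.1.1 0 = Posz n & st.2 = o].

(** Termination is part of the claim, as the main loop has to come round again. *)
Definition wp p N c (s : store) (Q : store -> Prop) : Prop :=
  forall st o, holds N s o st ->
  exists st' s', [/\ exec p c st st', holds N s' o st' & Q s'].

Section WP.
Variables (p : Baire) (N : nat).
Implicit Types (s : store) (Q : store -> Prop).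

Lemma wp_conseq c s Q Q' : (forall s', Q s' -> Q' s') -> wp p N c s Q -> wp p N c s Q'.
Proof.
by move=> QQ H st o /H [st' [s' [? ? /QQ ?]]]; exists st', s'.
Qed.

Lemma wp_seq c d s Q : wp p N c s (fun s' => wp p N d s' Q) -> wp p N (Seq c d) s Q.
Proof.
move=> H st o /H [st1 [s1 [E1 H1 /(_ _ _ H1)]]] [st2 [s2 [E2 H2 Q2]]].
by exists st2, s2; split => //; exact: exec_seq E1 E2.
Qed.

Definition Inc r := Atom (MoveR r.+1).
Definition Dec r := Atom (MoveL r.+1).
Definition WhileNZ r c := Until r.+1 1 c.

Lemma holds_upd s o h w r x (z : int) : holds N s o (h, w, o) -> z = Posz x ->
  holds N (upd s r x) o (upd h r.+1 z, w, o).
Proof.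
move=> [H1 [n H2] H3] ->; split => //=; last by exists n; rewrite /upd.
move=> i /H1[/= E1 E2]; split => //; rewrite /upd eqSS.
by case: eqP.
Qed.

Lemma wp_inc r s Q : r < N -> Q (upd s r (s r).+1) -> wp p N (Inc r) s Q.
Proof.
move=> rN HQ [[h w] o'] o H; have [H1 _ /= E] := H; subst o'.
exists (effect (MoveR r.+1) (h, w, o)), (upd s r (s r).+1).
split=> //; first exact: exec_atom.
by apply: holds_upd H _; have [/= -> _] := H1 r rN; lia.
Qed.

Lemma wp_dec r s Q : r < N -> 0 < s r -> Q (upd s r (s r).-1) -> wp p N (Dec r) s Q.
Proof.
move=> rN s0 HQ [[h w] o'] o H; have [H1 _ /= E] := H; subst o'.
exists (effect (MoveL r.+1) (h, w, o)), (upd s r (s r).-1).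
split=> //; first exact: exec_atom.
by apply: holds_upd H _; have [/= -> _] := H1 r rN; lia.
Qed.

Lemma scanned_reg s o st r : holds N s o st -> r < N ->
  (scanned p st r.+1 == 1) = (s r == 0).
Proof.
by move=> [H _ _] /H [E1 E2]; rewrite /scanned /scan /= E1 E2; case: (s r).
Qed.

Lemma wp_while r c (I : nat -> store -> Prop) n s Q : r < N ->
  (forall s, I 0 s -> s r = 0 /\ Q s) ->
  (forall k s, I k.+1 s -> 0 < s r /\ wp p N c s (I k)) ->
  I n s -> wp p N (WhileNZ r c) s Q.
Proof.
move=> rN I0 IS; elim: n s => [|n IH] s Is st o H.
  have [s0 Qs] := I0 _ Is; exists st, s; split => //; apply: exec_stop.
  by apply/eqP; rewrite (scanned_reg H) // s0.
have [s0 /(_ _ _ H) [st1 [s1 [E1 H1 I1]]]] := IS _ _ Is.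
have [st2 [s2 [E2 H2 Q2]]] := IH _ I1 _ _ H1.
exists st2, s2; split => //; apply: exec_loop E1 E2.
by rewrite (scanned_reg H) // -lt0n.
Qed.

Lemma updE (I : eqType) (T : Type) (f : I -> T) i v j : upd f i v j = if j == i then v else f j.
Proof. by []. Qed.

Lemma upd_upd (T : Type) (f : nat -> T) i v v' : upd (upd f i v) i v' = upd f i v'.
Proof. by apply/funext => j; rewrite /upd; case: eqP. Qed.

Definition Clear r := WhileNZ r (Dec r).

Lemma wp_clear r s Q : r < N -> Q (upd s r 0) -> wp p N (Clear r) s Q.
Proof.
move=> rN HQ; apply: (@wp_while _ _ (fun k s' => s' = upd s r k) (s r)) => //.
- by move=> _ ->; rewrite updE eqxx.
- move=> k _ ->; rewrite updE eqxx; split => //.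
  by apply: wp_dec; rewrite ?updE ?eqxx // upd_upd.
by apply/funext => j; rewrite updE; case: eqP => [->|].
Qed.

Definition Move x d := Seq (Clear d) (WhileNZ x (Seq (Dec x) (Inc d))).

Lemma wp_move x d s Q : x < N -> d < N -> x != d ->
  (forall s', s' d = s x -> (forall r, r != d -> r != x -> s' r = s r) -> Q s') ->
  wp p N (Move x d) s Q.
Proof.
move=> xN dN xd HQ; apply: wp_seq; apply: wp_clear => //.
have dx : d == x = false by rewrite eq_sym; exact: negbTE.
apply: (@wp_while _ _ (fun k s' => [/\ s' x = k, s' d + k = s x &
  forall r, r != d -> r != x -> s' r = s r]) (s x)) => //.
- by move=> s' [-> E H]; split => //; apply: HQ => //; rewrite addn0 in E.
- move=> k s' [E1 E2 H]; split; first by rewrite E1.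
  apply: wp_seq; apply: wp_dec => //; first by rewrite E1.
  apply: wp_inc => //; rewrite !updE !(eqxx, dx, negbTE xd) E1; split => //=.
    by rewrite addSnnS.
  by move=> r rd rx; rewrite !updE (negbTE rd) (negbTE rx) H.
rewrite !updE !(eqxx, negbTE xd); split => // r rd rx.
by rewrite updE (negbTE rd).
Qed.

Definition Copy x d t :=
  Seq (Clear d) (Seq (Clear t) (Seq
    (WhileNZ x (Seq (Dec x) (Seq (Inc d) (Inc t)))) (WhileNZ t (Seq (Dec t) (Inc x))))).

Lemma wp_copy x d t s Q : x < N -> d < N -> t < N -> uniq [:: x; d; t] ->
  (forall s', s' d = s x -> (forall r, r != d -> r != t -> s' r = s r) -> Q s') ->
  wp p N (Copy x d t) s Q.
Proof.
move=> xN dN tN; rewrite /= !inE !negb_or !andbT => /andP[/andP[xd xt] dt] HQ.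
have [dx tx td] : [/\ d == x = false, t == x = false & t == d = false].
  by split; rewrite eq_sym; exact: negbTE.
apply: wp_seq; apply: wp_clear => //; apply: wp_seq; apply: wp_clear => //.
apply: wp_seq.
apply: (@wp_while _ _ (fun k s' => [/\ s' x = k, s' d + k = s x, s' t + k = s x &
  forall r, r != d -> r != t -> r != x -> s' r = s r]) (s x)) => //.
- move=> s1 [E1 E2 E3 H]; split => //.
  apply: (@wp_while _ _ (fun k s' => [/\ s' t = k, s' x + k = s x, s' d = s x &
    forall r, r != d -> r != t -> r != x -> s' r = s r]) (s x)) => //.
  + move=> s' [F1 F2 F3 F4]; split => //; apply: HQ => // r rd rt.
    by case: (eqVneq r x) => [->|]; [rewrite -F2 addn0|exact: F4].
  + move=> k s' [F1 F2 F3 F4]; split; first by rewrite F1.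
    apply: wp_seq; apply: wp_dec => //; first by rewrite F1.
    apply: wp_inc => //.
    rewrite !updE !(eqxx, dx, tx, td, negbTE xt, negbTE xd, negbTE dt) F1; split => //=.
      by rewrite addSnnS.
    by move=> r rd rt rx; rewrite !updE (negbTE rx) (negbTE rt) F4.
  + by split => //; rewrite ?E1; lia.
- move=> k s' [F1 F2 F3 F4]; split; first by rewrite F1.
  apply: wp_seq; apply: wp_dec => //; first by rewrite F1.
  apply: wp_seq; apply: wp_inc => //; apply: wp_inc => //.
  rewrite !updE !(eqxx, dx, tx, td, negbTE xt, negbTE xd, negbTE dt) F1; split => //=.
  + by rewrite addSnnS.
  + by rewrite addSnnS.
  by move=> r rd rt rx; rewrite !updE (negbTE rd) (negbTE rx) (negbTE rt) F4.
rewrite !updE !(eqxx, dx, tx, td, negbTE xt, negbTE xd, negbTE dt); split => //.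
by move=> r rd rt rx; rewrite !updE (negbTE rd) (negbTE rt).
Qed.

(** The input word has to be searched from its beginning: skip as many blocks as
the register says, then count the next one in the same register. *)

Definition Rewind := Seq (Until 0 0 (Atom (MoveL 0))) (Atom (MoveR 0)).
Definition SkipBlock := Seq (Until 0 2 (Atom (MoveR 0))) (Atom (MoveR 0)).
Definition Query r := Seq (Seq Rewind (WhileNZ r (Seq (Dec r) SkipBlock)))
  (Until 0 2 (Seq (Atom (MoveR 0)) (Inc r))).

Definition set_head (h : nat -> int) (n : nat) : nat -> int := upd h 0 (Posz n).

Lemma exec_rewind h w o n : h 0 = Posz n ->
  exec p Rewind (h, w, o) (set_head h 0, w, o).
Proof.
move=> hn; apply: (@exec_seq _ _ _ _ (upd h 0 (-1)%R, w, o)).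
  elim: n h hn => [|n IH] h hn.
    apply: (@exec_loop _ _ _ _ _ (upd h 0 (-1)%R, w, o)).
    + by rewrite /scanned /scan /= hn input_cell_pos.
    + have := @exec_atom p (MoveL 0) (h, w, o) isT.
      by rewrite /= hn.
    + by apply: exec_stop.
  apply: (@exec_loop _ _ _ _ _ (upd h 0 (Posz n), w, o)).
  + by rewrite /scanned /scan /= hn input_cell_pos.
  + have := @exec_atom p (MoveL 0) (h, w, o) isT.
    by rewrite /= hn (_ : (Posz n.+1 - 1)%R = Posz n) //; lia.
  + by rewrite -(upd_upd h 0 (Posz n) (-1)%R); apply: IH; rewrite updE.
have := @exec_atom p (MoveR 0) (upd h 0 (-1)%R, w, o) isT.
by rewrite /= upd_upd updE.
Qed.

Lemma exec_skip h w o i : h 0 = Posz (block_start p i) ->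
  exec p SkipBlock (h, w, o) (set_head h (block_start p i.+1), w, o).
Proof.
move=> hi; apply: (@exec_seq _ _ _ _ (set_head h (block_start p i + p i), w, o)).
  have {hi} : h 0 = Posz (block_start p i + (p i - p i)) by rewrite subnn addn0.
  have : p i <= p i by [].
  move: {1 4}(p i) => k; elim: k h => [|k IH] h kp hi.
    rewrite (_ : set_head _ _ = h).
      apply: exec_stop; rewrite /scanned /scan /= hi input_cellE ?leq_subr //.
      by rewrite subn0 ltnn.
    by apply/funext => j; rewrite /set_head updE; case: eqP => // ->; rewrite hi subn0.
  apply: (@exec_loop _ _ _ _ _ (set_head h (block_start p i + (p i - k)), w, o)).
  + rewrite /scanned /scan /= hi input_cellE ?leq_subr //.
    by rewrite ifT // ltn_subrL /= (leq_ltn_trans _ kp).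
  + have := @exec_atom p (MoveR 0) (h, w, o) isT.
    rewrite /= hi (_ : (_ + 1)%R = Posz (block_start p i + (p i - k))) //; lia.
  + rewrite /set_head -(upd_upd h 0 (Posz (block_start p i + (p i - k)))
        (Posz (block_start p i + p i))).
    by apply: IH; [exact: ltnW|rewrite updE].
have := @exec_atom p (MoveR 0) (set_head h (block_start p i + p i), w, o) isT.
rewrite /= upd_upd /set_head updE /= block_startS addnS.
by rewrite (_ : (Posz _ + 1)%R = Posz (block_start p i + p i).+1) //; lia.
Qed.

Lemma wp_query r s Q : r < N -> Q (upd s r (p (s r))) -> wp p N (Query r) s Q.
Proof.
move=> rN HQ [[h w] o'] o [H1 [m /= hm] /= E]; subst o'.
have [/= hr wr] := H1 _ rN.
pose st k j := (upd (upd h 0 (Posz j)) r.+1 (Posz k), w, o) : state.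
have scr k j : (scanned p (st k j) r.+1 == 1) = (k == 0).
  by rewrite /scanned /scan /= updE eqxx wr; case: k.
have E1 : exec p Rewind (h, w, o) (st (s r) 0).
  suff -> : st (s r) 0 = (set_head h 0, w, o) by exact: exec_rewind hm.
  by rewrite /st -hr; congr (_, _, _); apply/funext => j; rewrite !updE; case: eqP => // ->.
have E2 k i : exec p (WhileNZ r (Seq (Dec r) SkipBlock))
    (st k (block_start p i)) (st 0 (block_start p (i + k))).
  elim: k i => [|k IH] i.
    by rewrite addn0; apply: exec_stop; apply/eqP; rewrite scr.
  apply: (@exec_loop _ _ _ _ _ (st k (block_start p i.+1))).
  + by rewrite scr.
  + apply: (@exec_seq _ _ _ _ (st k (block_start p i))).
      have := @exec_atom p (MoveL r.+1) (st k.+1 (block_start p i)) isT.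
      by rewrite /= upd_upd updE eqxx (_ : (Posz k.+1 - 1)%R = Posz k) //; lia.
    have := @exec_skip (st k (block_start p i)).1.1 w o i _; rewrite /= updE /=.
    move=> /(_ erefl); congr exec; congr (_, _, _).
    by apply/funext => j; rewrite !updE; case: j.
  + by rewrite addnS -addSn.
have E3 k : k <= p (s r) -> exec p (Until 0 2 (Seq (Atom (MoveR 0)) (Inc r)))
    (st (p (s r) - k) (block_start p (s r) + (p (s r) - k)))
    (st (p (s r)) (block_start p (s r) + p (s r))).
  elim: k => [|k IH] kp.
    rewrite subn0; apply: exec_stop.
    by rewrite /scanned /scan (input_cellE (leqnn _)) ltnn.
  apply: exec_loop (IH (ltnW kp)).
    rewrite /scanned /scan (input_cellE (leq_subr _ _)).
    by rewrite ifT // ltn_subrL /= (leq_ltn_trans _ kp).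
  apply: exec_seq; first exact: exec_atom.
  rewrite (_ : st (p (s r) - k) _ = effect (MoveR r.+1) (effect (MoveR 0)
     (st (p (s r) - k.+1) (block_start p (s r) + (p (s r) - k.+1))))).
    exact: exec_atom.
  congr (_, _, _); apply/funext => j; rewrite !updE /= eqxx.
  by case: j => [|j] /=; [|case: eqP => // _]; lia.
exists (st (p (s r)) (block_start p (s r) + p (s r))), (upd s r (p (s r))).
split => //; last first.
  split => //=; last by eexists; rewrite updE /= updE.
  move=> i /H1[/= hi wi]; split => //; rewrite !updE eqSS.
  by case: eqP.
apply: exec_seq; first apply: exec_seq E1 _.
  by have := E2 (s r) 0; rewrite {1}/block_start big_geq // add0n; exact.
by have := E3 _ (leqnn _); rewrite subnn addn0.
Qed.

End WP.

Lemma wp_succ p N b s (Q : store -> Prop) x : x < N -> b < N -> b.+1 < N -> x < b ->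
  (forall s', s' b = (s x).+1 -> (forall r, r < b -> s' r = s r) -> Q s') ->
  wp p N (Seq (Copy x b b.+1) (Inc b)) s Q.
Proof.
move=> xN bN b1N xb HQ; apply: wp_seq; apply: wp_copy => //.
  by rewrite /= !inE; lia.
move=> s' E H; apply: wp_inc => //; apply: HQ; first by rewrite updE eqxx E.
move=> r rb; rewrite updE ltn_eqF // H //; lia.
Qed.

(** * Compiling recursive functionals *)

(** Stack discipline: variables are kept below [b], the result goes to [b], and
what lies above [b] is scratch space of arbitrary initial contents. *)
Definition implements (D : set Baire) (F : Baire -> env -> nat) c (rho : nat -> nat) b N0 :=
  b < N0 /\ forall p, D p -> forall N, N0 <= N -> forall s, wp p N c s (fun s' =>
    s' b = F p (fun i => s (rho i)) /\ forall r, r < b -> s' r = s r).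

Lemma scons_comp (s : store) b rho : (fun i => s (scons b rho i)) = scons (s b) (fun i => s (rho i)).
Proof. by apply/funext => -[|i]. Qed.

Lemma env_eq (s s' : store) b (rho : nat -> nat) : (forall i, rho i < b) -> (forall r, r < b -> s' r = s r) ->
  (fun i => s' (rho i)) = (fun i => s (rho i)).
Proof. by move=> hr hs; apply/funext => i; exact: hs. Qed.

Lemma scons_lt b rho c : b < c -> (forall i, rho i < b) -> forall i, scons b rho i < c.
Proof. by move=> bc hr [|i] //=; exact: ltn_trans (hr i) bc. Qed.

Lemma recursive_implemented D F : recursive D F ->
  forall rho b, (forall i, rho i < b) -> exists c N0, implements D F c rho b N0.
Proof.
elim=> {F}.
- move=> F G _ IH FG rho b hr; have [c [N0 [bN H]]] := IH rho b hr.
  exists c, N0; split => // p Dp N lN s; apply: wp_conseq (H p Dp N lN s) => s'.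
  by rewrite FG.
- move=> rho b hr; exists (Clear b), b.+1; split => // p Dp N lN s.
  apply: wp_clear => //; rewrite updE eqxx; split => // r rb.
  by rewrite updE ltn_eqF.
- move=> rho b hr; exists (Seq (Copy (rho 0) b b.+1) (Inc b)), b.+2; split => // p Dp N lN s.
  have := hr 0 => h0.
  by apply: wp_succ; lia || by [].
- move=> i rho b hr; exists (Copy (rho i) b b.+1), b.+2; split => // p Dp N lN s.
  have := hr i => h0.
  apply: wp_copy; [lia|lia|lia| |].
    by rewrite /= !inE; lia.
  by move=> s' E H; split => // r rb; apply: H; lia.
- move=> rho b hr; exists (Seq (Copy (rho 0) b b.+1) (Query b)), b.+2; split => // p Dp N lN s.
  have := hr 0 => h0.
  apply: wp_seq; apply: wp_copy; [lia|lia|lia| |].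
    by rewrite /= !inE; lia.
  move=> s' E H; apply: wp_query; first lia.
  rewrite updE eqxx E; split => // r rb.
  by rewrite updE ltn_eqF // H //; lia.
- move=> F G _ IHF _ IHG rho b hr.
  have [cG [NG [bG HG]]] := IHG rho b hr.
  have [cF [NF [bF HF]]] := IHF _ _ (scons_lt (ltnSn b) hr).
  exists (Seq cG (Seq cF (Move b.+1 b))), (maxn NG NF); split; first lia.
  move=> p Dp N lN s.
  apply: wp_seq; apply: wp_conseq (HG p Dp N _ s); last lia.
  move=> s1 [E1 H1]; apply: wp_seq; apply: wp_conseq (HF p Dp N _ s1); last lia.
  move=> s2 [E2 H2]; apply: wp_move; [lia|lia|lia|].
  move=> s3 E3 H3; split.
    by rewrite E3 E2 scons_comp E1 (env_eq hr H1).
  by move=> r rb; rewrite H3 ?H2 ?H1 //; lia.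
- move=> F xi _ IH rho b hr.
  have [i|c [N0 H]] := IH (fun i => rho (xi i)) b; first exact: hr.
  by exists c, N0.
- move=> F G _ IHF _ IHG rho b hr.
  have [cF [NF [bF HF]]] := IHF rho b hr.
  have hrG : forall i, scons b.+1 (scons b rho) i < b.+3.
    by apply: (@scons_lt _ _ b.+3) => //; apply: scons_lt.
  have [cG [NG [bG HG]]] := IHG _ _ hrG.
  (* [b] holds the value reached, [b.+1] the round, [b.+2] the rounds left. *)
  exists (Seq cF (Seq (Clear b.+1) (Seq (Copy (rho 0) b.+2 b.+3)
    (WhileNZ b.+2 (Seq (Dec b.+2) (Seq cG (Seq (Move b.+3 b) (Inc b.+1)))))))), (maxn NF NG).
  split; first lia.
  move=> p Dp N lN s; have h0 := hr 0.
  apply: wp_seq; apply: wp_conseq (HF p Dp N _ s); last lia.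
  move=> s1 [E1 H1]; apply: wp_seq; apply: wp_clear; first lia.
  apply: wp_seq; apply: wp_copy; [lia|lia|lia| |].
    by rewrite /= !inE; lia.
  move=> s2 E2 H2.
  pose e i := s (rho i).
  pose R n := natrec (F p e) (fun n r => G p (scons n (scons r e))) n.
  apply: (@wp_while _ _ _ _ (fun k s' => [/\ s' b.+2 = k, s' b.+1 + k = e 0,
     s' b = R (s' b.+1) & forall r, r < b -> s' r = s r]) (e 0)).
  + lia.
  + by move=> s' [-> Es Eb H]; split => //; split => //; rewrite Eb /R -(addn0 (s' _)) Es.
  + move=> k s3 [F1 F2 F3 F4]; split; first by rewrite F1.
    apply: wp_seq; apply: wp_dec; [lia|by rewrite F1|rewrite F1 /=].
    apply: wp_seq; apply: wp_conseq (HG p Dp N _ _); last lia.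
    move=> s4 [E4 H4]; apply: wp_seq; apply: wp_move; [lia|lia|lia|].
    move=> s5 E5 H5; apply: wp_inc; first lia.
    have L r : r < b.+2 -> r != b -> s5 r = s3 r.
      move=> rb rb'; rewrite H5 ?H4 //; [|lia|lia].
      by rewrite updE ltn_eqF.
    have L1 : s5 b.+1 = s3 b.+1 by apply: L; lia.
    have L2 : s5 b.+2 = k.
      by rewrite H5 ?H4 //; [rewrite updE eqxx|lia|lia].
    have U r : upd s5 b.+1 (s5 b.+1).+1 r = if r == b.+1 then (s3 b.+1).+1 else s5 r.
      by rewrite L1.
    split.
    * by rewrite U gtn_eqF.
    * by rewrite U eqxx addSnnS.
    * rewrite !U eqxx ltn_eqF // E5 E4.
      rewrite !scons_comp updE ltn_eqF //= updE ltn_eqF // F3; congr (G p (scons _ (scons _ _))).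
      apply/funext => i; have := hr i => hi.
      by rewrite updE ltn_eqF ?F4 //; lia.
    * move=> r rb; rewrite updE ltn_eqF; last lia.
      by rewrite L ?F4 //; lia.
  + split; rewrite ?E2.
    * by rewrite updE ltn_eqF ?H1 //; lia.
    * rewrite H2 //; [|lia|lia]; rewrite updE eqxx; lia.
    * rewrite !H2; [|lia|lia|lia|lia]; rewrite !updE ltn_eqF // eqxx E1.
      by [].
    * by move=> r rb; rewrite H2 ?updE ?ltn_eqF ?H1 //; lia.
- move=> F G _ IH FG rho b hr.
  have [c [N0 [bN H]]] := IH _ _ (scons_lt (ltnSn b) hr).
  (* [b] holds the candidate, [b.+1] the value of [F] at it. *)
  exists (Seq (Clear b) (Seq c (WhileNZ b.+1 (Seq (Inc b) c)))), N0; split; first lia.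
  move=> p Dp N lN s; pose e i := s (rho i).
  have [G0 Gm] := FG p e Dp.
  apply: wp_seq; apply: wp_clear; first lia.
  apply: wp_seq; apply: wp_conseq (H p Dp N _ _); last lia.
  have env s' : (forall r, r < b -> s' r = s r) ->
      (fun i => s' (scons b rho i)) = scons (s' b) e.
    by move=> hs; rewrite scons_comp (env_eq hr hs).
  move=> s1 [E1 H1].
  apply: (@wp_while _ _ _ _ (fun k s' => [/\ s' b + k = G p e,
     s' b.+1 = F p (scons (s' b) e) & forall r, r < b -> s' r = s r]) (G p e)).
  + lia.
  + move=> s' [Eb Eb1 Hs]; rewrite addn0 in Eb; rewrite Eb1 Eb G0; split => //.
  + move=> k s' [Eb Eb1 Hs]; split.
      by rewrite Eb1 lt0n; apply: Gm; lia.
    apply: wp_seq; apply: wp_inc; first lia.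
    apply: wp_conseq (H p Dp N _ _); last lia.
    move=> s2 [E2 H2].
    have Hs2 r : r < b -> s2 r = s r.
      by move=> rb; rewrite H2 ?updE ?ltn_eqF ?Hs //; lia.
    have Es2 : s2 b = (s' b).+1 by rewrite H2 // updE eqxx.
    split => //; first by rewrite Es2; lia.
    rewrite E2 env; first by rewrite updE eqxx Es2.
    by move=> r rb; rewrite updE ltn_eqF // Hs.
  + have s1b : s1 b = 0 by rewrite H1 // updE eqxx.
    have Hs1 r : r < b -> s1 r = s r.
      by move=> rb; rewrite H1 ?updE ?ltn_eqF //; lia.
    rewrite s1b; split => //; rewrite E1 env ?updE ?eqxx //.
    by move=> r rb; rewrite updE ltn_eqF.
Qed.

Definition Emit r := Seq (WhileNZ r (Seq (Dec r) (Atom (Output 1)))) (Atom (Output 2)).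

Lemma exec_emit p N r s o st : r < N -> holds N s o st ->
  exists st', exec p (Emit r) st st' /\ holds N (upd s r 0) (o ++ block (s r)) st'.
Proof.
move=> rN H.
suff [st' [E H']] : exists st', exec p (WhileNZ r (Seq (Dec r) (Atom (Output 1)))) st st' /\
    holds N (upd s r 0) (o ++ nseq (s r) 1) st'.
  exists (effect (Output 2) st'); split; first exact: exec_seq E (exec_atom _ _ _).
  case: st' H' {E} => [[h w] o'] [H1 H2 /= H3]; split => //=.
  by rewrite H3 rcons_cat.
move en : (s r) => n; elim: n s o st H en => [|n IH] s o st H en.
  exists st; split; first by apply: exec_stop; apply/eqP; rewrite (scanned_reg p H) ?en.
  rewrite cats0; suff -> : upd s r 0 = s by [].
  by apply/funext => j; rewrite updE; case: eqP => // ->.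
have [st1 [s1 [E1 H1 Es1]]] : exists st' s', [/\ exec p (Dec r) st st', holds N s' o st' &
    s' = upd s r n].
  have := @wp_dec p N r s (fun s' => s' = upd s r n) rN.
  by rewrite en; apply.
rewrite Es1 in H1.
have H1' : holds N (upd s r n) (rcons o 1) (effect (Output 1) st1).
  by case: st1 H1 {E1} => [[h w] o'] [Ha Hb /= Hc]; split => //=; rewrite Hc.
have [|st' [E' H']] := IH _ _ _ H1'; first by rewrite updE eqxx.
exists st'; split; last by rewrite upd_upd -cats1 -catA in H'.
apply: exec_loop E'; first by rewrite (scanned_reg p H) // en.
by apply: exec_seq E1 _; exact: exec_atom.
Qed.

Fixpoint marks (n : nat) : prog :=
  if n is n'.+1 then Seq (marks n') (Atom (Write n 1)) else Atom (Write 0 0).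

Definition initial_state : state := (fun=> 0%R, fun _ _ => 0, [::]).

Lemma exec_marks p N : exists st, exec p (marks N) initial_state st /\
  [/\ st.1.1 = fun=> 0%R, forall t z, st.1.2 t z = ((0 < t <= N) && (z == 0%R)) & st.2 = [::]].
Proof.
elim: N => [|N [st [E [H1 H2 H3]]]].
  exists (effect (Write 0 0) initial_state); split; first exact: exec_atom.
  split => // t z /=; rewrite /upd; have -> : (0 < t <= 0) = false by lia.
  by case: ifP => // _; case: ifP.
exists (effect (Write N.+1 1) st); split; first exact: exec_seq E (exec_atom _ _ _).
case: st E H1 H2 H3 => [[h w] o] /= _ -> H2 ->; split => // t z; rewrite !updE.
case: eqP => [->|tN].
  by rewrite updE H2 leqnn; case: eqP => //= _; rewrite andbF.
by rewrite H2; congr (nat_of_bool (_ && _)); lia.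
Qed.

(** The compiled program runs forever: it keeps the index [n] in register 0,
computes the [n]-th value from it and emits the value as a block. *)
Theorem recursive_machine D (G : Baire -> Baire) :
  recursive D (fun p e => G p (e 0)) ->
  exists M, forall p, D p -> computes M p (G p).
Proof.
(* Variable 0 lives in register 0, all others in register 1. *)
move=> /recursive_implemented /(_ (scons 0 (fun=> 1)) 2) [[|i]//|c [N0 [bN0 H]]].
pose body := Seq c (Seq (Emit 2) (Inc 0)).
pose start := psize (marks N0).
pose M := compile (marks N0) 0 ++ compile body start ++ [:: Jump start].
exists M => p Dp.
have nth_right (s1 s2 : program) i : nth Halt (s1 ++ s2) (size s1 + i) = nth Halt s2 i.
  by rewrite nth_cat ltnNge leq_addr addKn.
have loc_init : located M (marks N0) 0.
  by move=> i ile; rewrite add0n nth_cat size_compile ile.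
have loc_body : located M body start.
  move=> i ile; rewrite /M /start -(size_compile (marks N0) 0) nth_right.
  by rewrite nth_cat size_compile ile.
have loc_jump : nth Halt M (start + psize body) = Jump start.
  have := nth_right (compile (marks N0) 0) (compile body start ++ [:: Jump start]) (psize body).
  rewrite size_compile => ->.
  by have := nth_right (compile body start) [:: Jump start] 0; rewrite addn0 size_compile.
have body_run n s st : s 0 = n -> holds N0 s (word (G p) n) st ->
    exists st' s' k, [/\ s' 0 = n.+1, holds N0 s' (word (G p) n.+1) st' &
      iter k (step M p) (at_line start st) = at_line start st'].
  move=> s0 /(H p Dp N0 (leqnn _)) [st1 [s1 [E1 H1 [s12 s1r]]]].
  have [st2 [E2 H2]] := exec_emit p (bN0 : 2 < N0) H1.
  have s10 : s1 0 = n by rewrite s1r.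
  have [|st3 [s3 [E3 H3 Es3]]] := @wp_inc p N0 0 (upd s1 2 0) (fun s => s 0 = n.+1)
    (ltnW (ltnW bN0)) _ _ _ H2; first by rewrite updE eqxx updE /= s10.
  have [k Ek] := exec_compile (exec_seq E1 (exec_seq E2 E3)) loc_body.
  exists st3, s3, k.+1; split; [exact: Es3| |by rewrite iterS Ek (step_jump _ _ loc_jump)].
  by move: H3; rewrite s12 /= s0 wordS.
have all_run n : exists st s k, [/\ s 0 = n, holds N0 s (word (G p) n) st &
    run M p k = at_line start st].
  elim: n => [|n [st [s [k [s0 Hs Ek]]]]].
    have [st [E [H1 H2 H3]]] := exec_marks p N0.
    have [k Ek] := exec_compile E loc_init.
    exists st, (fun=> 0), k; split => //.
    split => //; last by exists 0; rewrite H1.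
    by move=> r rN; rewrite H1; split => // z; rewrite H2 rN.
  have [st' [s' [k' [s0' Hs' Ek']]]] := body_run _ _ _ s0 Hs.
  by exists st', s', (k' + k); split => //; rewrite /run iterD -/(run M p k) Ek.
move=> n; have [st [s [k [_ [_ _ Eo] Ek]]]] := all_run n.
by exists k; rewrite Ek /= Eo prefix_refl.
Qed.

(** * Reading the output of a machine *)

(** The length of block [i] is the number of letters 1 preceded by exactly [i]
letters 2; it is defined for every output and final once the block is closed. *)

Definition ones_of_block (i : nat) (o : seq nat) : nat :=
  \sum_(0 <= j < size o) ((nth 0 o j == 1) && (count_mem 2 (take j o) == i)).

Lemma ones_of_block_rcons i o a : ones_of_block i (rcons o a) =
  ones_of_block i o + ((a == 1) && (count_mem 2 o == i)).
Proof.
rewrite /ones_of_block size_rcons big_nat_recr //= nth_rcons ltnn eqxx.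
rewrite -{3}cats1 take_size_cat //; congr (_ + _).
rewrite !big_mkord; apply: eq_bigr => j _.
by rewrite nth_rcons ltn_ord -cats1 takel_cat // ltnW.
Qed.

Lemma ones_of_block_cat i o1 o2 : i < count_mem 2 o1 ->
  ones_of_block i (o1 ++ o2) = ones_of_block i o1.
Proof.
move=> io; elim/last_ind: o2 => [|o2 a IH]; first by rewrite cats0.
rewrite -rcons_cat ones_of_block_rcons IH count_cat [_ + _ == i]gtn_eqF.
  by rewrite andbF addn0.
exact: ltn_addr.
Qed.

Lemma ones_of_block_future i o : count_mem 2 o < i -> ones_of_block i o = 0.
Proof.
elim/last_ind: o => [|o a IH]; first by rewrite /ones_of_block big_geq.
rewrite -cats1 count_cat cats1 ones_of_block_rcons => io.
have lo : count_mem 2 o < i by apply: leq_ltn_trans io; exact: leq_addr.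
by rewrite IH // [_ == i]ltn_eqF // andbF.
Qed.

Lemma count_block k : count_mem 2 (block k) = 1.
Proof. by rewrite /block -cats1 count_cat /= count_nseq. Qed.

Lemma count_word p n : count_mem 2 (word p n) = n.
Proof. by elim: n => // n IH; rewrite wordS count_cat count_block IH addn1. Qed.

Lemma ones_of_block_word p n i : i < n -> ones_of_block i (word p n) = p i.
Proof.
elim: n i => // n IH i; rewrite ltnS leq_eqVlt => /predU1P[->|lt_in]; last first.
  by rewrite wordS ones_of_block_cat ?count_word // IH.
rewrite wordS /block -rcons_cat ones_of_block_rcons addn0.
have count1 o k : count_mem 2 (o ++ nseq k 1) = count_mem 2 o.
  by rewrite count_cat count_nseq addn0.
have count_ones k : ones_of_block n (word p n ++ nseq k 1) = ones_of_block n (word p n) + k.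
  elim: k => [|k IHk]; first by rewrite /= cats0 addn0.
  rewrite -[k.+1]addn1 nseqD catA cats1 ones_of_block_rcons IHk count1.
  by rewrite count_word !eqxx addnA.
rewrite count_ones; suff -> : ones_of_block n (word p n) = 0 by [].
case: n {IH count_ones} => [|n]; first by rewrite /ones_of_block big_geq.
rewrite wordS /block -rcons_cat ones_of_block_rcons addn0 ones_of_block_future //.
by rewrite count1 count_word.
Qed.

Lemma ones_of_block_prefix p n i o : prefix (word p n) o -> i < n ->
  i < count_mem 2 o /\ ones_of_block i o = p i.
Proof.
case/prefixP => o' -> lt_in; rewrite count_cat ones_of_block_cat count_word //.
by rewrite ltn_addr // ones_of_block_word.
Qed.

Lemma runS M p k : run M p k.+1 = step M p (run M p k).
Proof. by []. Qed.

Lemma prefix_out M p k k' : k <= k' -> prefix (out (run M p k)) (out (run M p k')).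
Proof.
move=> kk; rewrite -(subnKC kk); elim: (k' - k) => [|d IH].
  by rewrite addn0 prefix_refl.
apply: prefix_trans IH _; rewrite addnS runS.
case: (run M p (k + d)) => l hd w o; rewrite /step.
by case: (nth Halt M l) => * //=; rewrite ?prefix_refl ?prefix_rcons.
Qed.

Lemma computes_out M p q k i : computes M p q -> i < count_mem 2 (out (run M p k)) ->
  ones_of_block i (out (run M p k)) = q i.
Proof.
move=> /(_ i.+1) [k' Hk'] ik.
have [H1 H2] := ones_of_block_prefix Hk' (ltnSn i).
case: (leqP k k') => kk.
  have /prefixP[o E] := prefix_out M p kk.
  by move: H2; rewrite E ones_of_block_cat.
have /prefixP[o E] := prefix_out M p (ltnW kk).
by rewrite E ones_of_block_cat.
Qed.

Lemma computes_inj M p q q' : computes M p q -> computes M p q' -> q = q'.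
Proof.
move=> h h'; apply/funext => i; have [k Hk] := h i.+1.
have [H1 <-] := ones_of_block_prefix Hk (ltnSn i).
exact: (computes_out h').
Qed.

Lemma the_uniqueP (T : Type) (P : set T) x : the_unique P = Some x -> P x.
Proof.
by rewrite /the_unique; case: pselect => // ex [<-]; exact: projT2 (cid ex).
Qed.

Lemma the_unique_eq (T : Type) (P : set T) x : P x -> (forall y, P y -> y = x) ->
  the_unique P = Some x.
Proof.
move=> Px H; rewrite /the_unique; case: pselect => [ex|]; last by case; exists x.
by congr Some; apply: H; exact: projT2 (cid ex).
Qed.

Lemma PhiE n p q : Phi n p = Some q <-> computes (machine n) p q.
Proof.
split; first exact: the_uniqueP.
by move=> h; apply: the_unique_eq => // q' h'; exact: computes_inj h' h.
Qed.

Theorem recursive_Phi D (G : Baire -> Baire) :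
  recursive D (fun p e => G p (e 0)) -> exists n, forall p, D p -> Phi n p = Some (G p).
Proof.
move=> /recursive_machine [M HM]; have [n En] := machine_surj M.
by exists n => p /HM; rewrite -En => /PhiE.
Qed.

(** * Simulation of an arbitrary machine *)

(** The only thing stored about a run is its trace, the line reached at each
step.  It determines the rest: head positions are differences of numbers of
moves, a cell holds what was written last at its position, and the output is
the sequence of output instructions.  Below, [n] is the number of the machine,
[l j] is its line at step [j], and the numerals that codes of instructions are
compared with are those of [instr_of]. *)

Definition opcode (n : nat) (l : nat -> nat) j := arg n (l j) %% 7.
Definition operand (n : nat) (l : nat -> nat) j i := arg (arg n (l j) %/ 7) i.

Definition uses d n l k t : nat :=
  \sum_(0 <= j < k) ((opcode n l j == d) && (operand n l j 0 == t)).

(** The symbol under the head of work tape [t] at step [k].  Head positions are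
differences of two counts, and are compared after moving the subtracted counts
to the other side. *)
Definition content n l k t : nat :=
  natrec 0 (fun j v =>
    if (opcode n l j == 3) && (operand n l j 0 == t) &&
       (uses 2 n l j t + uses 1 n l k t == uses 2 n l k t + uses 1 n l j t)
    then operand n l j 1 else v) k.

(** The input symbol at position [r - l]: a 2 exactly at the last cell before
the start of a block. *)
Definition input_symbol (p : nat -> nat) (r l : nat) : nat :=
  if r < l then 0 else
  if 0 < \sum_(0 <= i < (r - l).+1) (block_start p i.+1 == (r - l).+1) then 2 else 1.

Definition symbol (p : nat -> nat) n l k t : nat :=
  if t == 0 then input_symbol p (uses 2 n l k 0) (uses 1 n l k 0) else content n l k t.

Definition next_line p n l k : nat :=
  if opcode n l k == 0 then l k else
  if opcode n l k == 4 then
    if symbol p n l k (operand n l k 0) == operand n l k 1 then operand n l k 2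
    else (l k).+1
  else if opcode n l k == 5 then operand n l k 0 else (l k).+1.

(** Traces are coded most recent line first, so that a step is a [cons]. *)
Definition recall (w k : nat) : nat -> nat := fun j => arg w (k - j).

Definition trace p n k : nat :=
  natrec (ccons 0 0) (fun k w => ccons (next_line p n (recall w k) k) w) k.

(** Value [i] of the output, plus one, or 0 as long as its block is not closed
after [k] steps. *)
Definition partial_value p n k i : nat :=
  let l := recall (trace p n k) k in
  if i < uses 6 n l k 2 then
    (\sum_(0 <= j < k) ((opcode n l j == 6) && (operand n l j 0 == 1) &&
                        (uses 6 n l j 2 == i))).+1
  else 0.

Section SimulationRecursive.
Variable D : set Baire.

Ltac unfold_code := rewrite /opcode /operand /recall.

Lemma rec_uses d n w m k t : recursive D n -> recursive D w -> recursive D m ->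
  recursive D k -> recursive D t ->
  recursive D (fun p e => uses d (n p e) (recall (w p e) (m p e)) (k p e) (t p e)).
Proof.
apply: (rec_app5 (f := fun _ n w m k t => uses d n (recall w m) k t)).
by rewrite /uses; unfold_code; rec.
Qed.

Ltac rec' := repeat first [apply: rec_uses | rec_step].

Lemma rec_content n w m k t : recursive D n -> recursive D w -> recursive D m ->
  recursive D k -> recursive D t ->
  recursive D (fun p e => content (n p e) (recall (w p e) (m p e)) (k p e) (t p e)).
Proof.
apply: (rec_app5 (f := fun _ n w m k t => content n (recall w m) k t)).
by rewrite /content; unfold_code; rec'.
Qed.

Lemma rec_next_line n w m k : recursive D n -> recursive D w -> recursive D m ->
  recursive D k ->
  recursive D (fun p e => next_line p (n p e) (recall (w p e) (m p e)) (k p e)).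
Proof.
apply: (rec_app4 (f := fun p n w m k => next_line p n (recall w m) k)).
rewrite /next_line /symbol /input_symbol /block_start; unfold_code.
by repeat first [apply: rec_content | rec'].
Qed.

Lemma rec_partial_value n k i : recursive D n -> recursive D k -> recursive D i ->
  recursive D (fun p e => partial_value p (n p e) (k p e) (i p e)).
Proof.
apply: (rec_app3 (f := fun p n k i => partial_value p n k i)).
have hT : recursive D (fun p e => trace p (e 0) (e 1)).
  by rewrite /trace; rec; apply: rec_next_line; rec.
have hW := rec_app2 hT.
rewrite /partial_value /=; unfold_code.
by repeat first [apply: hW | rec'].
Qed.
End SimulationRecursive.

Section Simulation.
Variables (n : nat) (p : Baire).
Local Notation M := (machine n).
Let lines (k : nat) := line (run M p k).

Lemma nth_machine l : nth Halt (machine n) l = instr_of (arg n l).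
Proof.
rewrite /machine /arg; case: (ltnP l (size (CodeSeq.decode n))) => h.
  by rewrite (nth_map 0).
by rewrite !nth_default ?size_map.
Qed.

Lemma usesS d l k t : uses d n l k.+1 t =
  uses d n l k t + ((opcode n l k == d) && (operand n l k 0 == t)).
Proof. by rewrite /uses big_nat_recr. Qed.

Lemma input_cellP r l : input_cell p (Posz r - Posz l)%R = input_symbol p r l.
Proof.
rewrite /input_symbol; case: ltnP => rl.
  by have -> : (Posz r - Posz l)%R = Negz (l - r).-1 by lia.
have -> : (Posz r - Posz l)%R = Posz (r - l) by lia.
move: (r - l) => z {r l rl}.
have [i [o [op zE]]] : exists i o, o <= p i /\ z = block_start p i + o.
  elim: z => [|z [i [o [op ->]]]]; first by exists 0, 0; rewrite /block_start big_geq.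
  case: (ltnP o (p i)) => h; first by exists i, o.+1; rewrite addnS.
  exists i.+1, 0; rewrite block_startS addn0 addnS; split => //.
  by congr (_ + _).+1; apply/eqP; rewrite eqn_leq op.
have mono a b : a <= b -> block_start p a <= block_start p b.
  elim: b => [|b IH]; first by rewrite leqn0 => /eqP ->.
  by rewrite leq_eqVlt block_startS => /predU1P[->|/IH h]; rewrite ?block_startS //; lia.
rewrite zE input_cellE //; case: (ltnP o (p i)) => h.
  rewrite ifN // -leqNgt leqn0; apply/eqP; apply: big1 => j _.
  apply/eqP; rewrite eqb0; apply/eqP => E.
  have h1 : block_start p i < block_start p j.+1 by lia.
  have h2 : block_start p j.+1 < block_start p i.+1 by rewrite (block_startS p i); lia.
  by case: (ltnP i j.+1) => h3; have := mono _ _ h3; lia.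
rewrite ifT //.
have ile : i < (block_start p i + o).+1.
  by rewrite ltnS; apply: leq_trans (leq_block_start p i) _; exact: leq_addr.
rewrite (bigD1_seq i) ?iota_uniq ?mem_index_iota //=.
by rewrite block_startS -addnS (_ : o = p i) ?eqxx //; lia.
Qed.

Lemma run_uses k t : head (run M p k) t = (Posz (uses 2 n lines k t) - Posz (uses 1 n lines k t))%R.
Proof.
elim: k => [|k IH]; first by rewrite /uses !big_geq.
rewrite runS !usesS.
move: (uses 2 n lines k t) (uses 1 n lines k t) IH => U2 U1; rewrite /opcode /operand /lines.
case: (run M p k) => l h w o /= IH; rewrite nth_machine /instr_of.
have := ltn_pmod (arg n l) (isT : 0 < 7).
case: (arg n l %% 7) => [|[|[|[|[|[|[|c]]]]]]] //= _; rewrite ?addn0 //.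
- by rewrite updE eq_sym; case: eqP => [E|_]; rewrite ?E ?IH; lia.
- by rewrite updE eq_sym; case: eqP => [E|_]; rewrite ?E ?IH; lia.
Qed.

Lemma run_content k t z : work (run M p k) t z = natrec 0 (fun j v =>
    if (opcode n lines j == 3) && (operand n lines j 0 == t) &&
       (head (run M p j) t == z) then operand n lines j 1 else v) k.
Proof.
elim: k => [//|k IH]; rewrite runS /= -IH /opcode /operand /lines.
case: (run M p k) {IH} => l h w o /=; rewrite nth_machine /instr_of.
have := ltn_pmod (arg n l) (isT : 0 < 7).
case: (arg n l %% 7) => [|[|[|[|[|[|[|c]]]]]]] //= _.
rewrite updE eq_sym; case: eqP => //= <-; rewrite updE eq_sym.
by [].
Qed.

Lemma natrec_ext a f g k : (forall j v, j < k -> f j v = g j v) -> natrec a f k = natrec a g k.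
Proof.
elim: k => //= k IH H; rewrite -/(natrec _ _ _) -/(natrec _ _ _) IH ?H // => j v jk.
by apply: H; exact: ltnW.
Qed.

Lemma run_symbol k t : scan p (run M p k) t = symbol p n lines k t.
Proof.
rewrite /scan /symbol; case: eqP => _; first by rewrite run_uses input_cellP.
rewrite run_content /content; apply: natrec_ext => j v _; congr (if _ && _ then _ else _).
rewrite !run_uses; move: (uses _ _ _ _ _) (uses _ _ _ _ _) (uses _ _ _ _ _) (uses _ _ _ _ _) => a b c d.
by apply/eqP/eqP; lia.
Qed.

Lemma run_next_line k : lines k.+1 = next_line p n lines k.
Proof.
have := run_symbol k; rewrite /next_line.
move: (symbol p n lines k) => S; rewrite /opcode /operand /lines runS.
case: (run M p k) => l h w o /= HS; rewrite nth_machine /instr_of.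
have := ltn_pmod (arg n l) (isT : 0 < 7).
by case: (arg n l %% 7) => [|[|[|[|[|[|[|c]]]]]]] //= _; rewrite HS.
Qed.

Lemma run_count k a : count_mem a (out (run M p k)) = uses 6 n lines k a.
Proof.
elim: k => [|k IH]; first by rewrite /uses big_geq.
rewrite runS usesS -IH /opcode /operand /lines.
case: (run M p k) {IH} => l h w o /=; rewrite nth_machine /instr_of.
have := ltn_pmod (arg n l) (isT : 0 < 7).
case: (arg n l %% 7) => [|[|[|[|[|[|[|c]]]]]]] //= _; rewrite ?addn0 //.
by rewrite -cats1 count_cat /= addn0.
Qed.

Lemma run_ones k i : ones_of_block i (out (run M p k)) =
  \sum_(0 <= j < k) ((opcode n lines j == 6) && (operand n lines j 0 == 1) &&
                        (uses 6 n lines j 2 == i)).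
Proof.
elim: k => [|k IH]; first by rewrite /ones_of_block !big_geq.
rewrite runS big_nat_recr //= -IH -run_count /opcode /operand /lines.
case: (run M p k) {IH} => l h w o /=; rewrite nth_machine /instr_of.
have := ltn_pmod (arg n l) (isT : 0 < 7).
case: (arg n l %% 7) => [|[|[|[|[|[|[|c]]]]]]] //= _; rewrite ?addn0 //.
by rewrite ones_of_block_rcons.
Qed.

Section Ext.
Variables (l l' : nat -> nat) (k : nat).
Hypothesis ll' : forall j, j <= k -> l j = l' j.

Lemma uses_ext d j t : j <= k -> uses d n l j t = uses d n l' j t.
Proof.
move=> jk; rewrite /uses !big_mkord; apply: eq_bigr => i _.
by rewrite /opcode /operand ll' // ltnW // (leq_trans _ jk).
Qed.

Lemma next_line_ext : next_line p n l k = next_line p n l' k.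
Proof.
have hs t : symbol p n l k t = symbol p n l' k t.
  rewrite /symbol !uses_ext //; case: eqP => // _; rewrite /content.
  by apply: natrec_ext => j v jk; rewrite !uses_ext ?(ltnW jk) // /opcode /operand ll' // ltnW.
by rewrite /next_line hs /opcode /operand ll'.
Qed.
End Ext.

Lemma recall_trace k j : j <= k -> recall (trace p n k) k j = lines j.
Proof.
elim: k j => [|k IH] j.
  by rewrite leqn0 => /eqP ->; rewrite /recall arg_ccons0.
rewrite /recall /= -/(trace p n k) leq_eqVlt => /predU1P[->|jk].
  by rewrite subnn arg_ccons0 run_next_line; exact: next_line_ext.
by rewrite subSn // arg_cconsS; exact: IH.
Qed.

Lemma partial_valueE k i : partial_value p n k i =
  if i < count_mem 2 (out (run M p k)) then (ones_of_block i (out (run M p k))).+1 else 0.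
Proof.
rewrite /partial_value run_count run_ones.
have H := @recall_trace k; rewrite (uses_ext H) //; case: ifP => // _; congr _.+1.
rewrite !big_mkord; apply: eq_bigr => j _.
by rewrite /opcode /operand (uses_ext H) ?H // ltnW.
Qed.

Lemma partial_value_Phi q k i : Phi n p = Some q ->
  partial_value p n k i = 0 \/ partial_value p n k i = (q i).+1.
Proof.
move=> /PhiE hq; rewrite partial_valueE; case: ifP => h; [right|by left].
by rewrite (computes_out hq).
Qed.

Lemma partial_value_exists q i : Phi n p = Some q ->
  exists k, partial_value p n k i = (q i).+1.
Proof.
move=> /PhiE hq; have [k Hk] := hq i.+1; exists k.
by have [h E] := ones_of_block_prefix Hk (ltnSn i); rewrite partial_valueE h E.
Qed.
End Simulation.

(** The number of the machine may be computed from the oracle too.  One waits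
for value [e 0] to be completed; the search ends because the promise says that
the machine has an output. *)
Theorem universality D (N : Baire -> env -> nat) (O Q : Baire -> Baire) :
  recursive D (fun p e => O p (e 0)) -> recursive D N ->
  (forall p e, D p -> Phi (N p e) (O p) = Some (Q p)) ->
  recursive D (fun p e => Q p (e 0)).
Proof.
move=> hO hN HQ.
pose T p e := partial_value (O p) (e 0) (e 1) (e 2).
have hT : recursive D T.
  apply: (rec_subst (E := setT) (F := fun p e => partial_value p (e 0) (e 1) (e 2)) hO) => //.
  by apply: rec_partial_value; rec.
have hT3 A B C : recursive D A -> recursive D B -> recursive D C ->
    recursive D (fun p e => partial_value (O p) (A p e) (B p e) (C p e)).
  exact: (rec_app3 (f := fun p a b c => partial_value (O p) a b c) hT).
have stops p e : D p -> exists k, partial_value (O p) (N p e) k (e 0) != 0.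
  by move=> /(HQ _ e)/(@partial_value_exists _ _ _ (e 0))[k E]; exists k; rewrite E.
(* The least sufficient number of steps, as found by search. *)
pose m p e := if pselect (D p) is left Dp then ex_minn (stops p e Dp) else 0.
have hm : recursive D m.
  apply: (@rec_mu _ (fun p e =>
    nat_of_bool (partial_value (O p) (N p (fun i => e i.+1)) (e 0) (e 1) == 0))).
    by apply: rec_eq; [apply: hT3; [exact: (rec_rename S hN)|rec|rec]|rec].
  move=> p e Dp; rewrite /m; case: pselect => // Dp'; case: ex_minnP => k hk kmin.
  split; first by apply/eqP; rewrite eqb0.
  by move=> j jk; rewrite eqb0 negbK; apply: contraTT jk => /kmin; rewrite -leqNgt.
apply: (@rec_ext _ (fun p e => (partial_value (O p) (N p e) (m p e) (e 0)).-1)).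
  by apply: rec_pred; apply: hT3 => //; rec.
move=> p e Dp; rewrite /m; case: pselect => // Dp'; case: ex_minnP => k hk _.
by case: (partial_value_Phi k (e 0) (HQ p e Dp)) hk => ->.
Qed.

(** * Continuity *)

Definition agree (N : nat) (p p' : nat -> nat) := forall i, i < N -> p' i = p i.

Lemma agree_le M N p p' : M <= N -> agree N p p' -> agree M p p'.
Proof. by move=> MN H i iM; apply: H; exact: leq_trans iM MN. Qed.

(** A terminating computation reads finitely many values of the oracle. *)
Lemma recursive_continuous D F : recursive D F -> forall (p : Baire), D p -> forall e,
  exists N, forall p' : Baire, D p' -> agree N p p' -> F p' e = F p e.
Proof.
elim=> {F}.
- move=> F G _ IH FG p Dp e; have [N HN] := IH p Dp e.
  by exists N => p' Dp' pp'; rewrite !FG // HN.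
- by move=> p _ e; exists 0.
- by move=> p _ e; exists 0.
- by move=> i p _ e; exists 0.
- by move=> p _ e; exists (e 0).+1 => p' _; apply.
- move=> F G _ IHF _ IHG p Dp e.
  have [NG HG] := IHG p Dp e; have [NF HF] := IHF p Dp (scons (G p e) e).
  exists (maxn NG NF) => p' Dp' pp'.
  by rewrite HG ?HF //; apply: agree_le pp'; rewrite ?leq_maxl ?leq_maxr.
- by move=> F xi _ IH p Dp e; exact: IH.
- move=> F G _ IHF _ IHG p Dp e; elim: (e 0) => [|n [N HN]]; first exact: IHF.
  set r := natrec _ _ n in HN *.
  have [N' HN'] := IHG p Dp (scons n (scons r e)).
  exists (maxn N N') => p' Dp' pp' /=; rewrite -/(natrec _ _ n) HN //.
    by apply: HN' => //; apply: agree_le pp'; exact: leq_maxr.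
  by apply: agree_le pp'; exact: leq_maxl.
- move=> F G _ IH FG p Dp e; have [G0 Gm] := FG p e Dp.
  have [N HN] : exists N, forall j, j < (G p e).+1 -> forall p' : Baire, D p' -> agree N p p' ->
      F p' (scons j e) = F p (scons j e).
    elim: (_.+1) => [|m [N HN]]; first by exists 0.
    have [N' HN'] := IH p Dp (scons m e).
    exists (maxn N N') => j; rewrite ltnS leq_eqVlt => /predU1P[->|jm] p' Dp' pp'.
      by apply: HN' => //; apply: agree_le pp'; exact: leq_maxr.
    by apply: HN => //; apply: agree_le pp'; exact: leq_maxl.
  exists N => p' Dp' pp'; have [G0' Gm'] := FG p' e Dp'.
  case: (ltngtP (G p' e) (G p e)) => // h.
    by have := Gm _ h; rewrite -(HN _ _ p') // ?G0' // ltnS ltnW.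
  by have := Gm' _ h; rewrite HN // G0.
Qed.

Lemma Phi_continuous n p q i : Phi n p = Some q -> exists N, forall p' q' : Baire,
  agree N p p' -> Phi n p' = Some q' -> q' i = q i.
Proof.
move=> /(@partial_value_exists _ _ _ i) [k Ek].
have h : recursive setT (fun p e => partial_value p (e 0) (e 1) (e 2)).
  by apply: rec_partial_value; exact: rec_var.
have [N HN] := recursive_continuous h (I : setT p) (scons n (scons k (scons i (fun=> 0)))).
exists N => p' q' pp' E; have /= := HN p' I pp'; rewrite Ek.
by case: (partial_value_Phi k i E) => -> // [].
Qed.

Lemma nbhs_agree (p : Baire) N : nbhs p [set p' : Baire | agree N p p'].
Proof.
have h : nbhs p [set p' : Baire | forall i : 'I_N, p' i = p i].
  have := (@filter_forall Baire 'I_N (fun i (p' : Baire) => p' i = p i) (nbhs p) _); apply.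
  move=> i.
  have /discrete_cvg := @proj_continuous nat (fun=> nat) i p.
  by apply.
by apply: filterS h => p' h i iN; exact: (h (Ordinal iN)).
Qed.

Lemma pcontinuous_Phi n (q : Baire) : pcontinuous (fun r => Phi n (bpair q r)).
Proof.
apply/subspace_continuousP => r; rewrite /pdom /=.
case E : (Phi n (bpair q r)) => [s|] // _ /=.
apply/(@pointwise_cvgP nat nat) => i; apply/discrete_cvg.
have [N HN] := Phi_continuous i E.
suff : nbhs r [set r' | isSome (Phi n (bpair q r')) ->
    (odflt r' (Phi n (bpair q r'))) i = (odflt r (Phi n (bpair q r))) i].
  by move=> h; exact: h.
rewrite E /=.
apply: filterS (nbhs_agree r N) => r' rr'.
rewrite /=; case E' : (Phi n (bpair q r')) => [s'|//] _.
apply: (HN _ _ _ E') => j jN; rewrite /bpair; case: ifP => // _.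
by apply: rr'; apply: leq_ltn_trans jN; lia.
Qed.

(** * Computable maps of Baire space *)

Definition computable_map (D : set Baire) (O : Baire -> Baire) : Prop :=
  recursive D (fun p e => O p (e 0)).

Section ComputableMaps.
Variable D : set Baire.

Lemma cmap_id : computable_map D (fun p => p).
Proof. by apply: rec_oracle; rec. Qed.

Lemma cmap_comp E O O' : computable_map E O' -> computable_map D O ->
  (forall p, D p -> E (O p)) -> computable_map D (fun p => O' (O p)).
Proof. by move=> hO' hO DE; exact: (rec_subst hO DE hO'). Qed.

Lemma cmap_app O A : computable_map D O -> recursive D A ->
  recursive D (fun p e => O p (A p e)).
Proof. by move=> hO hA; exact: (rec_app1 (f := fun p x => O p x) hO). Qed.

Lemma cmap_fst O : computable_map D O -> computable_map D (fun p => fstB (O p)).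
Proof. by move=> hO; apply: (cmap_app hO); rec. Qed.

Lemma cmap_snd O : computable_map D O -> computable_map D (fun p => sndB (O p)).
Proof. by move=> hO; apply: (cmap_app hO); rec. Qed.

Lemma cmap_pair O O' : computable_map D O -> computable_map D O' ->
  computable_map D (fun p => bpair (O p) (O' p)).
Proof.
move=> hO hO'; apply: rec_if; first by rec.
  by apply: (cmap_app hO'); rec.
by apply: (cmap_app hO); rec.
Qed.

Lemma cmap_total O : computable_map setT O -> computable_map D O.
Proof. exact: rec_total. Qed.

End ComputableMaps.

Lemma cmap_sub (D E : set Baire) O : D `<=` E -> computable_map E O -> computable_map D O.
Proof. exact: rec_sub_dom. Qed.

Lemma computable_cmap D O F : computable_map D O ->
  (forall p q, F p = Some q -> D p /\ q = O p) -> computable F.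
Proof.
move=> /recursive_Phi [n Hn] HF; exists n => p q /HF [Dp ->].
exact: Hn.
Qed.

Lemma fst_bpair p q : fstB (bpair p q) = p.
Proof. by apply/funext => i; rewrite /fstB /bpair odd_double doubleK. Qed.

Lemma snd_bpair p q : sndB (bpair p q) = q.
Proof. by apply/funext => i; rewrite /sndB /bpair /= odd_double /= uphalf_double. Qed.

Lemma bpair_fst_snd x : bpair (fstB x) (sndB x) = x.
Proof.
apply/funext => i; rewrite /bpair /fstB /sndB; case: ifP => h.
  by rewrite -[in RHS](odd_double_half i) h.
by rewrite -[in RHS](odd_double_half i) h.
Qed.

(** * Semidecision *)

(** Rejection is the appearance of a 0, so that acceptance is co-semidecidable
and matches the naming of closed sets by their complements. *)

Definition accepts (V : Baire -> Baire) (x : Baire) : Prop := forall m, V x m != 0.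

(** Entry [m], read as a pair of a number of steps and an index, is 0 when the
machine has by then output 0 at that index.  Unlike the output of the machine,
this is defined for every [x]. *)
Definition screen (n : nat) (x : Baire) : Baire :=
  fun m => nat_of_bool (partial_value x n (arg m 0) (arg m 1) != 1).

Lemma cmap_screen D n : computable_map D (screen n).
Proof.
apply: rec_not; apply: rec_eq; last by rec.
by apply: rec_partial_value; rec.
Qed.

Lemma accepts_screen n x q : Phi n x = Some q ->
  accepts (screen n) x <-> forall i, q i != 0.
Proof.
move=> E; split => [h i|h m].
  have [k Ek] := partial_value_exists i E.
  have := h (CodeSeq.code [:: k; i]); rewrite /screen !arg_code /= Ek.
  by case: (q i).
rewrite /screen; case: (partial_value_Phi (arg m 0) (arg m 1) E) => -> //.
by have := h (arg m 1); case: (q _).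
Qed.

(** * Names of closed sets *)

Section ClosedSets.
Variable X : space.
Hypothesis repX : represented X.

Definition tailB (p : Baire) : Baire := fun i => p i.+1.
Definition closed_name (p : Baire) : pfun Baire Baire :=
  fun r => Phi (p 0) (bpair (tailB p) r).

Lemma Aminus_rep_realizes p (S : Aminus X) : rep (Aminus X) p = Some S ->
  realizes (closed_name p) (chi (~` sval S)).
Proof. exact: the_uniqueP. Qed.

Lemma chi_realizer F (A : set X) r x : realizes F (chi (~` A)) -> rep X r = Some x ->
  exists2 q, F r = Some q & (forall i, q i != 0) <-> A x.
Proof.
move=> hF rx; have [|q [b [E [<-] Hb]]] := hF r x rx; first by exists `[< (~` A) x >].
exists q => //; have {}Hb : (exists n, q n = 0) <-> (~` A) x.
  by move: Hb; rewrite /chi /= => Hb; split => /asboolP; [rewrite Hb|rewrite -Hb] => /asboolP.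
split => [h|Ax i].
  apply: contrapT => /Hb [i E0]; by have := h i; rewrite E0.
by apply/eqP => E0; have : (~` A) x by (apply/Hb; exists i).
Qed.

Lemma Aminus_rep_eq p (S : Aminus X) : realizes (closed_name p) (chi (~` sval S)) ->
  rep (Aminus X) p = Some S.
Proof.
move=> hS; apply: the_unique_eq => // S' hS'.
case: S S' hS hS' => [A cA] [A' cA'] /= hS hS'; apply: eq_exist.
apply/seteqP; split => x; have [r rx] := repX x.
  have [q E <-] := chi_realizer hS' rx.
  by have [q' E' <-] := chi_realizer hS rx; case: (etrans (esym E) E') => ->.
have [q E <-] := chi_realizer hS rx.
by have [q' E' <-] := chi_realizer hS' rx; case: (etrans (esym E) E') => ->.
Qed.

(** A set semidecided by a machine from outside is closed, since computable
functions are continuous, and the machine provides a name of it. *)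
Lemma closed_named p (A : set X) : realizes (closed_name p) (chi (~` A)) ->
  exists S : Aminus X, rep (Aminus X) p = Some S /\ sval S = A.
Proof.
move=> hA; have cA : is_closed A.
  by exists (closed_name p); split => //; exact: pcontinuous_Phi.
by exists (exist _ A cA); split => //; exact: Aminus_rep_eq.
Qed.
End ClosedSets.

(** * Computation with advice *)

(** The verifier [V] is required to be total: the rejection of a piece of advice
must not depend on the termination of a computation that uses this advice. *)
Definition advised (A : set Baire) (Y Z : space) (f : mvf Y Z) : Prop :=
  exists (V : Baire -> Baire) (n : nat), computable_map setT V /\
  forall p y, rep Y p = Some y -> mdom f y ->
    (exists2 a, A a & accepts V (bpair p a)) /\
    forall a, A a -> accepts V (bpair p a) ->
      exists q z, [/\ Phi n (bpair p a) = Some q, rep Z q = Some z & f y z].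

Definition pairs (A B : set Baire) : set Baire := [set x | A (fstB x) /\ B (sndB x)].

(** A total extension of [Phi n], to be used under the promise that [Phi n] is
defined. *)
Definition run_of (n : nat) (x : Baire) : Baire := odflt x (Phi n x).

Lemma cmap_run D O n : computable_map D O -> (forall p, D p -> isSome (Phi n (O p))) ->
  computable_map D (fun p => run_of n (O p)).
Proof. 
move=> hO H; apply: (universality hO (rec_const D n)) => p _ /H.
by rewrite /run_of; case: Phi.
Qed.

Lemma run_ofE n x q : Phi n x = Some q -> run_of n x = q.
Proof. by rewrite /run_of => ->. Qed.

Ltac cmap := repeat first [exact: cmap_id | exact: (cmap_fst (cmap_id _)) | exact: (cmap_snd (cmap_id _)) | apply: cmap_pair | apply: cmap_fst | apply: cmap_snd].

Section Choice.
Variable X : space.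
Hypothesis repX : represented X.

Lemma the_unique_some (T : Type) (P : set T) : (exists x, P x) -> exists2 x, the_unique P = Some x & P x.
Proof.
move=> ex; rewrite /the_unique; case: pselect => // ex'.
by exists (projT1 (cid ex')) => //; exact: projT2 (cid ex').
Qed.

(** A realizer of closed choice without values outside the domain: if a
reduction succeeds with it, its query was the name of a nonempty closed set. *)
Definition some_choice (h : Baire) : option Baire :=
  the_unique [set q | exists S x, [/\ rep (Aminus X) h = Some S, rep X q = Some x & sval S x]].

Lemma some_choice_realizer : realizes some_choice (@closed_choice X).
Proof.
move=> h S hS [x Sx]; have [r rx] := repX x.
have [|q E [S' [x' [ES Ex Sx']]]] := @the_unique_some _ [set q | exists S x,
  [/\ rep (Aminus X) h = Some S, rep X q = Some x & sval S x]].
  by exists r, S, x.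
exists q, x'; split => //; move: ES; rewrite hS => -[E'].
by rewrite /closed_choice E'.
Qed.

(** Reductions have to work for every realizer, hence for every name of every
point of the closed set. *)
Lemma realizer_through h (S : Aminus X) r x :
  rep (Aminus X) h = Some S -> rep X r = Some x -> sval S x ->
  exists2 G, realizes G (@closed_choice X) & G h = Some r.
Proof.
move=> hS rx Sx; exists (fun h' => if `[< h' = h >] then Some r else some_choice h').
  move=> h' S' hS' S'0; case: ifP => [/asboolP E|_]; last exact: some_choice_realizer hS' S'0.
  by exists r, x; split => //; move: hS'; rewrite E hS => -[<-].
by rewrite asboolT.
Qed.

(** The map [d] turns advice into names and has to reach every point of [X],
but not every name.  The closed set asked for by the reduction has a name
computed from the input, and its first entry is the number of a machine;
running this machine on the name [d a] takes universality.  The machine has a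
total output when [d a] is a name and the input is in the domain, and
[screen] makes a total verifier of it. *)
Lemma advised_of_wle (A : set Baire) (d : Baire -> Baire) (Y Z : space) (f : mvf Y Z) :
  computable_map A d -> (forall a, A a -> exists x, rep X (d a) = Some x) ->
  (forall x, exists2 a, A a & rep X (d a) = Some x) ->
  wle f (@closed_choice X) -> advised A f.
Proof.
move=> hd dX dsurj [K [H [[kn hK] [hn hH] red]]].
(* A good input is a name of an instance of [f]. *)
pose good p := exists2 y, rep Y p = Some y & mdom f y.
have named p : good p -> exists h (S : Aminus X), [/\ H p = Some h,
    rep (Aminus X) h = Some S & exists x, sval S x].
  move=> [y py fy]; have [q [z [+ _ _]]] := red _ some_choice_realizer p y py fy.
  case: (H p) => [h|] //=; case E : (some_choice h) => [r|] //= _.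
  have [S [x [hS _ Sx]]] := the_uniqueP E.
  by exists h, S; split => //; exists x.
have solves p y h S r x : rep Y p = Some y -> mdom f y -> H p = Some h ->
    rep (Aminus X) h = Some S -> rep X r = Some x -> sval S x ->
    exists q z, [/\ K (bpair p r) = Some q, rep Z q = Some z & f y z].
  move=> py fy Hp hS rx Sx; have [G GC Gh] := realizer_through hS rx Sx.
  have [q [z [+ qz fz]]] := red G GC p y py fy.
  by rewrite Hp /= Gh /= => Kq; exists q, z.
(* [h x] is the name of the closed set asked for on input [fstB x]; below, [v x]
   is its membership test run on the name [d (sndB x)]. *)
pose h x := run_of hn (fstB x).
have hE x p k : fstB x = p -> H p = Some k -> h x = k.
  by move=> xp Hp; apply: run_ofE; apply: hH; rewrite xp.
pose D : set Baire := [set x | good (fstB x) /\ A (sndB x)].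
have ch : computable_map D h.
  apply: cmap_run; first by cmap.
  by move=> x [/named [k [S [/hH -> _ _]]] _].
have cd : computable_map D (fun x => d (sndB x)).
  by apply: (cmap_comp hd); [cmap|move=> x []].
pose v x := run_of (h x 0) (bpair (tailB (h x)) (d (sndB x))).
have vP x p y S : D x -> fstB x = p -> rep (Aminus X) (h x) = Some S -> rep X (d (sndB x)) = Some y ->
    Phi (h x 0) (bpair (tailB (h x)) (d (sndB x))) = Some (v x) /\
    ((forall i, v x i != 0) <-> sval S y).
  move=> Dx xp hS dy; have [q E Eq] := chi_realizer (Aminus_rep_realizes hS) dy.
  by rewrite /v (run_ofE E).
have cv : computable_map D v.
  apply: (universality (N := fun x _ => h x 0) (O := fun x => bpair (tailB (h x)) (d (sndB x)))).
  - by apply: cmap_pair => //; apply: (cmap_app ch); rec.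
  - by apply: (cmap_app ch); rec.
  move=> x e Dx; have [/named [k [S [Hp kS _]]] Ax] := Dx.
  have [y dy] := dX _ Ax; rewrite -(hE x _ _ erefl Hp) in kS.
  by have [] := vP x _ y S Dx erefl kS dy.
have [nv Hnv] := recursive_Phi cv.
pose E : set Baire := [set x | D x /\ accepts (screen nv) x].
have acceptsE p a h' (S : Aminus X) x : good p -> A a -> H p = Some h' ->
    rep (Aminus X) h' = Some S -> rep X (d a) = Some x ->
    accepts (screen nv) (bpair p a) <-> sval S x.
  move=> gp Aa Hp hS dx.
  have Dx : D (bpair p a) by rewrite /D /= fst_bpair snd_bpair.
  have hx : h (bpair p a) = h' by apply: (hE _ p) => //; exact: fst_bpair.
  have := vP (bpair p a) p x S Dx (fst_bpair _ _).
  rewrite hx snd_bpair => /(_ hS dx) [_ <-].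
  exact: accepts_screen (Hnv _ Dx).
have cF : computable_map E (fun x => run_of kn (bpair (fstB x) (d (sndB x)))).
  apply: cmap_run.
    by apply: cmap_pair; [cmap|apply: cmap_sub cd => x []].
  move=> x [[gp Ax] acc]; have [y py fy] := gp.
  have [k [S [Hp kS _]]] := named _ gp; have [z dz] := dX _ Ax.
  have : sval S z by rewrite -(acceptsE _ _ _ _ _ gp Ax Hp kS dz) bpair_fst_snd.
  by move=> /(solves _ _ _ _ _ _ py fy Hp kS dz) [q [_ [/hK -> _ _]]].
have [nF HnF] := recursive_Phi cF.
exists (screen nv), nF; split; first exact: cmap_screen.
move=> p y py fy; have gp : good p by exists y.
have [k [S [Hp kS [x Sx]]]] := named _ gp; split.
  by have [a Aa dx] := dsurj x; exists a => //; apply/(acceptsE _ _ _ _ _ gp Aa Hp kS dx).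
move=> a Aa acc; have [z dz] := dX _ Aa.
have Sz : sval S z by apply/(acceptsE _ _ _ _ _ gp Aa Hp kS dz).
have [q [t [Kq qt ft]]] := solves _ _ _ _ _ _ py fy Hp kS dz Sz.
exists q, t; split => //; rewrite HnF.
  by rewrite fst_bpair snd_bpair; congr Some; apply: run_ofE; exact: hK.
by split => //; rewrite /D /= fst_bpair snd_bpair.
Qed.

Definition consB (n : nat) (p : Baire) : Baire := fun i => if i is j.+1 then p j else n.

(** The names accepted by [w] are those which encode advice, decoded by [d].
Advice encoded in a point must be the same for all names of the point:
otherwise a point could have accepted and rejected names at the same time, and
the accepted advice would define no subset of [X]. *)
Lemma wle_of_advised (A : set Baire) (d w : Baire -> Baire) (Y Z : space) (f : mvf Y Z) :
  computable_map setT d -> computable_map setT w ->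
  (forall r r' x, rep X r = Some x -> rep X r' = Some x -> accepts w r ->
    accepts w r' /\ d r' = d r) ->
  (forall r x, rep X r = Some x -> accepts w r -> A (d r)) ->
  (forall a, A a -> exists r x, [/\ rep X r = Some x, accepts w r & d r = a]) ->
  advised A f -> wle f (@closed_choice X).
Proof.
move=> cd cw ext wA wsurj [V [n [cV HV]]].
pose test x : Baire := fun m =>
  nat_of_bool ((V (bpair (fstB x) (d (sndB x))) m != 0) && (w (sndB x) m != 0)).
have cdx D : computable_map D (fun x => bpair (fstB x) (d (sndB x))).
  by apply: cmap_pair; [cmap|apply: (cmap_comp cd) => //; cmap].
have ct : computable_map setT test.
  apply: rec_and; (apply: rec_not; apply: rec_eq; last exact: rec_const).
    by apply: (cmap_app (O := fun x => V (bpair (fstB x) (d (sndB x))))); [exact: (cmap_comp cV)|rec].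
  by apply: (cmap_app (O := fun x => w (sndB x))); [apply: (cmap_comp cw) => //; cmap|rec].
have [nt Hnt] := recursive_Phi ct.
pose good p := exists2 y, rep Y p = Some y & mdom f y.
pose D : set Baire := [set x | [/\ good (fstB x), A (d (sndB x)) &
  accepts V (bpair (fstB x) (d (sndB x)))]].
have cF : computable_map D (fun x => run_of n (bpair (fstB x) (d (sndB x)))).
  apply: cmap_run => // x [[y py fy] Ax acc].
  by have [_ /(_ _ Ax acc) [q [z [-> _ _]]]] := HV _ _ py fy.
have [nF HnF] := recursive_Phi cF.
(* The name of the closed set is the number of a machine for [test], with the
   input as its parameter. *)
exists (Phi nF), (fun p => Some (consB nt p)); split.
- by exists nF.
- apply: (@computable_cmap setT (consB nt)) => [|p q [<-]] //.
  apply: (@rec_ext _ (fun p e => if e 0 == 0 then nt else p (e 0).-1)); first by rec.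
  by move=> p e _; case: (e 0).
move=> G hG p y py fy.
have [[a0 Aa0 acc0] sol] := HV p y py fy.
pose S : set X := [set x | exists r, [/\ rep X r = Some x, accepts w r & accepts V (bpair p (d r))]].
have [|Sc [pS SE]] := @closed_named X repX (consB nt p) S.
  move=> r x rx _; rewrite /closed_name Hnt //.
  exists (test (bpair p r)), `[< exists i, test (bpair p r) i = 0 >]; split => //.
  rewrite /chi /=; apply/asbool_equiv_eq; split.
    move=> [i Ei] [r' [r'x acc accV]]; move: Ei.
    have [accr dr] := ext _ _ _ r'x rx acc.
    by rewrite /test fst_bpair snd_bpair accr dr accV.
  move=> nS; apply: contrapT => nex; apply: nS; exists r; split => // i.
    apply/negP => wi; apply: nex; exists i.
    by rewrite /test fst_bpair snd_bpair wi andbF.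
  apply/negP => Vi; apply: nex; exists i.
  by rewrite /test fst_bpair snd_bpair Vi.
have [r0 [x0 [r0x w0 d0]]] := wsurj _ Aa0.
have S0 : mdom (@closed_choice X) Sc.
  by exists x0; rewrite /closed_choice SE; exists r0; split => //; rewrite d0.
have [r [x [Gr rx]]] := hG _ _ pS S0.
rewrite /closed_choice SE => -[r' [r'x acc accV]].
have [accr dr] := ext _ _ _ r'x rx acc.
have Adr := wA _ _ rx accr.
have [|q [z [Eq qz fz]]] := sol _ Adr; first by rewrite dr.
exists q, z; split => //=; rewrite Gr /= HnF.
  by rewrite fst_bpair snd_bpair (run_ofE Eq).
rewrite /D /= fst_bpair snd_bpair; split => //; first by exists y.
by rewrite dr.
Qed.
End Choice.

Lemma advised_pullback (A B : set Baire) d (Y Z : space) (f : mvf Y Z) :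
  computable_map setT d -> (forall a, A a -> B (d a)) ->
  (forall b, B b -> exists2 a, A a & d a = b) -> advised B f -> advised A f.
Proof.
move=> cd dAB dsurj [V [n [cV HV]]].
have cdx D : computable_map D (fun x => bpair (fstB x) (d (sndB x))).
  by apply: cmap_pair; [cmap|apply: (cmap_comp cd) => //; cmap].
pose W x := V (bpair (fstB x) (d (sndB x))).
pose D : set Baire := [set x | isSome (Phi n (bpair (fstB x) (d (sndB x))))].
have cF : computable_map D (fun x => run_of n (bpair (fstB x) (d (sndB x)))).
  by apply: cmap_run.
have [nF HnF] := recursive_Phi cF.
exists W, nF; split; first exact: (cmap_comp cV).
move=> p y py fy; have [[b Bb acc] sol] := HV p y py fy.
have WE a : W (bpair p a) = V (bpair p (d a)) by rewrite /W fst_bpair snd_bpair.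
split.
  have [a Aa da] := dsurj _ Bb; exists a => // m.
  by rewrite WE da.
move=> a Aa accW; have [|q [z [E qz fz]]] := sol _ (dAB _ Aa).
  by move=> m; rewrite -WE.
exists q, z; split => //; rewrite HnF.
  by rewrite fst_bpair snd_bpair (run_ofE E).
by rewrite /D /= fst_bpair snd_bpair E.
Qed.

(** If the advice for [g] is wrong, the intermediate result need not exist; the
verifier of [f] is therefore applied to it through [screen], which keeps
producing output while it waits for the intermediate result. *)
Lemma advised_comp (A B : set Baire) (X Y Z : space) (g : mvf X Y) (f : mvf Y Z) :
  advised A g -> advised B f -> advised (pairs A B) (mcomp f g).
Proof.
move=> [Vg [ng [cVg Hg]]] [Vf [nf [cVf Hf]]].
pose in1 x := bpair (fstB x) (fstB (sndB x)).
have c1 D : computable_map D in1 by cmap.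
pose mid x := bpair (run_of ng (in1 x)) (sndB (sndB x)).
pose D : set Baire := [set x | isSome (Phi ng (in1 x))].
have cmid : computable_map D mid.
  by apply: cmap_pair; [exact: cmap_run|cmap].
have cT : computable_map D (fun x => Vf (mid x)) by exact: (cmap_comp cVf).
have [nT HnT] := recursive_Phi cT.
pose V x : Baire := fun m => nat_of_bool ((Vg (in1 x) m != 0) && (screen nT x m != 0)).
have cV : computable_map setT V.
  apply: rec_and; (apply: rec_not; apply: rec_eq; last exact: rec_const).
    by apply: (cmap_app (O := fun x => Vg (in1 x))); [exact: (cmap_comp cVg)|rec].
  by apply: (cmap_app (cmap_screen setT nT)); rec.
pose E : set Baire := [set x | D x /\ isSome (Phi nf (mid x))].
have cF : computable_map E (fun x => run_of nf (mid x)).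
  by apply: cmap_run; [apply: cmap_sub cmid => x []|move=> x []].
have [nF HnF] := recursive_Phi cF.
have VP x : accepts V x <-> accepts Vg (in1 x) /\ accepts (screen nT) x.
  split=> [h|[h1 h2] m]; last by rewrite /V h1 h2.
  by split => m; have := h m; rewrite /V eqb0 negbK => /andP[].
exists V, nF; split => // p x px [z [gf [y0 gy0 fz0]]].
have gx : mdom g x by exists y0.
have [[a Aa acca] sol] := Hg p x px gx; split.
  have [q [y [Eq qy gy]]] := sol a Aa acca.
  have [[b Bb accb] _] := Hf q y qy (gf _ gy).
  have in1E : in1 (bpair p (bpair a b)) = bpair p a by rewrite /in1 !(fst_bpair, snd_bpair).
  have midE : mid (bpair p (bpair a b)) = bpair q b.
    by rewrite /mid in1E (run_ofE Eq) !(fst_bpair, snd_bpair).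
  exists (bpair a b); first by rewrite /pairs /= fst_bpair snd_bpair.
  apply/VP; rewrite in1E; split => //.
  have Dx : D (bpair p (bpair a b)) by rewrite /D /= in1E Eq.
  by apply/(accepts_screen (HnT _ Dx)); rewrite midE.
move=> c [Ac Bc] /VP.
have in1E : in1 (bpair p c) = bpair p (fstB c) by rewrite /in1 !(fst_bpair, snd_bpair).
rewrite in1E => -[acc1 acc2].
have [q [y [Eq qy gy]]] := sol _ Ac acc1.
have midE : mid (bpair p c) = bpair q (sndB c).
  by rewrite /mid in1E (run_ofE Eq) !(fst_bpair, snd_bpair).
have Dx : D (bpair p c) by rewrite /D /= in1E Eq.
have accf : accepts Vf (bpair q (sndB c)).
  by have /(accepts_screen (HnT _ Dx)) := acc2; rewrite midE.
have [_ /(_ _ Bc accf) [s [t [Es st ft]]]] := Hf q y qy (gf _ gy).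
exists s, t; split => //; last by split => //; exists y.
rewrite HnF; first by rewrite midE (run_ofE Es).
by split => //; rewrite midE Es.
Qed.

Lemma prod_repP (X Y : space) r xy : rep (prodS X Y) r = Some xy <->
  rep X (fstB r) = Some xy.1 /\ rep Y (sndB r) = Some xy.2.
Proof.
rewrite /= /prod_rep; case: (rep X (fstB r)) => [x|]; last by split => [|[]].
case: (rep Y (sndB r)) => [y|] /=; last by split => [|[]].
by case: xy => x' y'; split => [[<- <-]|[[<-] [<-]]].
Qed.

Lemma advised_prod (A B : set Baire) (X Y Z W : space) (f : mvf X Y) (g : mvf Z W) :
  advised A f -> advised B g -> advised (pairs A B) (mprod f g).
Proof.
move=> [Vf [nf [cVf Hf]]] [Vg [ng [cVg Hg]]].
pose in1 x := bpair (fstB (fstB x)) (fstB (sndB x)).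
pose in2 x := bpair (sndB (fstB x)) (sndB (sndB x)).
have c1 D : computable_map D in1 by cmap.
have c2 D : computable_map D in2 by cmap.
pose V x : Baire := fun m => nat_of_bool ((Vf (in1 x) m != 0) && (Vg (in2 x) m != 0)).
have cV : computable_map setT V.
  apply: rec_and; (apply: rec_not; apply: rec_eq; last exact: rec_const).
    by apply: (cmap_app (O := fun x => Vf (in1 x))); [exact: (cmap_comp cVf)|rec].
  by apply: (cmap_app (O := fun x => Vg (in2 x))); [exact: (cmap_comp cVg)|rec].
have VP x : accepts V x <-> accepts Vf (in1 x) /\ accepts Vg (in2 x).
  split=> [h|[h1 h2] m]; last by rewrite /V h1 h2.
  by split => m; have := h m; rewrite /V eqb0 negbK => /andP[].
pose E : set Baire := [set x | isSome (Phi nf (in1 x)) /\ isSome (Phi ng (in2 x))].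
have cF : computable_map E (fun x => bpair (run_of nf (in1 x)) (run_of ng (in2 x))).
  by apply: cmap_pair; apply: cmap_run => // x [].
have [nF HnF] := recursive_Phi cF.
exists V, nF; split => // p [x z] /prod_repP /= [px pz] [[y w] /= [fy gw]].
have [|[a Aa acca] solf] := Hf _ x px; first by exists y.
have [|[b Bb accb] solg] := Hg _ z pz; first by exists w.
split.
  exists (bpair a b); first by rewrite /pairs /= fst_bpair snd_bpair.
  by apply/VP; rewrite /in1 /in2 !(fst_bpair, snd_bpair).
move=> c [Ac Bc] /VP; rewrite /in1 /in2 !(fst_bpair, snd_bpair) => -[acc1 acc2].
have [q1 [y1 [E1 qy1 fy1]]] := solf _ Ac acc1.
have [q2 [y2 [E2 qy2 gy2]]] := solg _ Bc acc2.
exists (bpair q1 q2), (y1, y2); split => //; last first.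
  by apply/prod_repP; rewrite fst_bpair snd_bpair.
rewrite HnF /E /= /in1 /in2 !(fst_bpair, snd_bpair) ?E1 ?E2 //.
by rewrite (run_ofE E1) (run_ofE E2).
Qed.

Lemma wle_refl (X Y : space) (f : mvf X Y) : wle f f.
Proof.
exists (fun x => Some (sndB x)), (fun p => Some p); split.
- by apply: (@computable_cmap setT sndB) => [|p q [<-]] //; cmap.
- by apply: (@computable_cmap setT (fun p => p)) => [|p q [<-]] //; cmap.
move=> G hG p x px fx; have [q [y [E qy fy]]] := hG p x px fx.
by exists q, y; split => //=; rewrite E /= snd_bpair.
Qed.

Lemma wle_square (X Y : space) (f : mvf X Y) : wle f (mprod f f).
Proof.
exists (fun x => Some (fstB (sndB x))), (fun p => Some (bpair p p)); split.
- by apply: (@computable_cmap setT (fun x => fstB (sndB x))) => [|p q [<-]] //; cmap.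
- by apply: (@computable_cmap setT (fun p => bpair p p)) => [|p q [<-]] //; cmap.
move=> G hG p x px [y fy].
have [||q [[y1 y2] [E /prod_repP [qy _] [fy1 _]]]] := hG (bpair p p) (x, x).
- by apply/prod_repP; rewrite fst_bpair snd_bpair.
- by exists (y, y).
by exists (fstB q), y1; split => //=; rewrite E /= snd_bpair.
Qed.

(** * A criterion for closure under composition and product *)

(** [A] is a set of advice as powerful as closed choice on [X], [name] and
[decode] translate between the two, [test] singles out the names which encode
advice, and [split_advice] makes two pieces of advice out of one. *)
Section Criterion.
Variables (X : space) (A : set Baire) (name decode test split_advice : Baire -> Baire).
Hypotheses (c_name : computable_map setT name) (c_decode : computable_map setT decode)
  (c_test : computable_map setT test) (c_split : computable_map setT split_advice).
Hypothesis name_rep : forall a, A a -> exists x, rep X (name a) = Some x.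
Hypothesis name_onto : forall x, exists2 a, A a & rep X (name a) = Some x.
Hypothesis decode_ext : forall r r' x, rep X r = Some x -> rep X r' = Some x ->
  accepts test r -> accepts test r' /\ decode r' = decode r.
Hypothesis decode_advice : forall r x, rep X r = Some x -> accepts test r -> A (decode r).
Hypothesis decode_onto : forall a, A a ->
  exists r x, [/\ rep X r = Some x, accepts test r & decode r = a].
Hypothesis split_pairs : forall a, A a -> pairs A A (split_advice a).
Hypothesis split_onto : forall b, pairs A A b -> exists2 a, A a & split_advice a = b.

Lemma choice_represented : represented X.
Proof. by move=> x; have [a _ ax] := name_onto x; exists (name a). Qed.

Lemma wle_choiceP (Y Z : space) (f : mvf Y Z) : wle f (@closed_choice X) <-> advised A f.
Proof.
split.
  by apply: (advised_of_wle choice_represented _ name_rep name_onto); exact: cmap_total.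
exact: (wle_of_advised choice_represented c_decode c_test decode_ext decode_advice decode_onto).
Qed.

Lemma choice_criterion :
  closed_under_composition (@closed_choice X) /\ widempotent (@closed_choice X).
Proof.
have square (Y Z : space) (f : mvf Y Z) : advised (pairs A A) f -> wle f (@closed_choice X).
  by move=> /(advised_pullback c_split split_pairs split_onto) /wle_choiceP.
split.
  move=> Y1 Y2 Y3 f g _ _ _ /wle_choiceP hf /wle_choiceP hg.
  by apply: square; exact: advised_comp.
split; last exact: wle_square.
by apply: square; apply: advised_prod; apply/wle_choiceP; exact: wle_refl.
Qed.
End Criterion.

(** * Natural numbers, Cantor space, Baire space *)

(** A natural number has many names, as only the first entry counts; the
canonical one is used as advice. *)
Definition nat_advice : set Baire := [set r | forall i, r i.+1 = 0].
Definition cantor_advice : set Baire := [set r | forall i, r i <= 1].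

Definition only (n : nat) : Baire := fun i => if i == 0 then n else 0.
Definition always (r : Baire) : Baire := fun=> 1.

Lemma nat_adviceE r : nat_advice r <-> r = only (r 0).
Proof. by split => [h|->] //; apply/funext => -[|i] //; rewrite h. Qed.

Lemma cmap_always D : computable_map D always.
Proof. exact: (rec_const D 1). Qed.

Lemma cmap_only D N : recursive D (fun p _ => N p) ->
  computable_map D (fun p => only (N p)).
Proof. by move=> hN; apply: rec_if; [rec|exact: hN|rec]. Qed.

Lemma only0 n : only n 0 = n.
Proof. by []. Qed.

Lemma natS_choice_closed :
  closed_under_composition (@closed_choice natS) /\ widempotent (@closed_choice natS).
Proof.
apply: (@choice_criterion natS nat_advice (fun r => r) (fun r => only (r 0)) always
  (fun r => bpair (only (arg (r 0) 0)) (only (arg (r 0) 1)))).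
- exact: cmap_id.
- by apply: cmap_only; rec.
- exact: cmap_always.
- by apply: cmap_pair; apply: cmap_only; rec.
- by move=> a _; exists (a 0).
- by move=> x; exists (only x).
- by move=> r r' x [->] [->].
- by [].
- by move=> a /nat_adviceE aE; exists a, (a 0); split => //; rewrite -aE.
- by move=> a _; split; rewrite ?fst_bpair ?snd_bpair.
move=> b [/nat_adviceE b1 /nat_adviceE b2].
exists (only (CodeSeq.code [:: fstB b 0; sndB b 0])) => //.
by rewrite only0 !arg_code /= -b1 -b2 bpair_fst_snd.
Qed.

Lemma cantor_repP p x : rep cantorS p = Some x <-> forall n, p n = nat_of_bool (x n).
Proof.
split; first exact: the_uniqueP.
move=> h; apply: the_unique_eq => // y hy; apply/funext => n.
by have := h n; rewrite hy; case: (x n) (y n) => [] [].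
Qed.

Lemma cantor_advice_rep a : cantor_advice a -> rep cantorS a = Some (fun n => a n == 1).
Proof. by move=> h; apply/cantor_repP => n; have := h n; case: (a n) => [|[]]. Qed.

Lemma cantor_rep_advice a x : rep cantorS a = Some x -> cantor_advice a.
Proof. by move/cantor_repP => h n; rewrite h; case: (x n). Qed.

Lemma cantor_rep_inj a a' x : rep cantorS a = Some x -> rep cantorS a' = Some x -> a' = a.
Proof. by move=> /cantor_repP h /cantor_repP h'; apply/funext => n; rewrite h h'. Qed.

Lemma cantor_named x : rep cantorS (fun n => nat_of_bool (x n)) = Some x.
Proof. exact/cantor_repP. Qed.

Lemma cantorS_choice_closed :
  closed_under_composition (@closed_choice cantorS) /\ widempotent (@closed_choice cantorS).
Proof.
apply: (@choice_criterion cantorS cantor_advice (fun r => r) (fun r => r) always (fun r => r));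
  try exact: cmap_id; try exact: cmap_always.
- by move=> a /cantor_advice_rep E; eexists; exact: E.
- move=> x; exists (fun n => nat_of_bool (x n)); last exact: cantor_named.
  exact: cantor_rep_advice (cantor_named x).
- by move=> r r' x hr hr'; rewrite (cantor_rep_inj hr hr').
- by move=> r x /cantor_rep_advice.
- by move=> a /cantor_advice_rep E; exists a; eexists; split; first exact: E.
- by move=> a ha; split => i; exact: ha.
move=> b [h1 h2]; exists b => // i; rewrite -[b]bpair_fst_snd /bpair.
by case: ifP.
Qed.

Lemma baireS_choice_closed :
  closed_under_composition (@closed_choice baireS) /\ widempotent (@closed_choice baireS).
Proof.
apply: (@choice_criterion baireS setT (fun r => r) (fun r => r) always (fun r => r));
  try exact: cmap_id; try exact: cmap_always; try by [].
- by move=> a _; exists a.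
- by move=> x; exists x.
- by move=> r r' x [->] [->].
- by move=> a _; exists a, a.
by move=> b _; exists b.
Qed.

(** * The product of the natural numbers and Cantor space *)
Definition nat_cantor_advice := pairs nat_advice cantor_advice.

(** The number is split by its decoding as a sequence, the 0-1 sequence into its
even and odd positions. *)
Definition nat_cantor_split (x : Baire) : Baire :=
  bpair (bpair (only (arg (fstB x 0) 0)) (fstB (sndB x)))
        (bpair (only (arg (fstB x 0) 1)) (sndB (sndB x))).

Lemma cmap_nat_cantor_split D : computable_map D nat_cantor_split.
Proof.
have h : recursive D (fun p _ => fstB p 0).
  by apply: (cmap_app (cmap_fst (cmap_id _))); rec.
by apply: cmap_pair; apply: cmap_pair; cmap; apply: cmap_only; apply: rec_arg; first [exact: h|rec].
Qed.

Lemma nat_cantor_split_pairs a : nat_cantor_advice a -> pairs nat_cantor_advice nat_cantor_advice (nat_cantor_split a).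
Proof.
move=> [_ h2]; split; split; rewrite !(fst_bpair, snd_bpair) //.
  by move=> i; exact: h2.
by move=> i; exact: h2.
Qed.

Lemma nat_cantor_split_onto b : pairs nat_cantor_advice nat_cantor_advice b -> exists2 a, nat_cantor_advice a & nat_cantor_split a = b.
Proof.
move=> [[/nat_adviceE n1 b1] [/nat_adviceE n2 b2]].
exists (bpair (only (CodeSeq.code [:: fstB (fstB b) 0; fstB (sndB b) 0]))
   (bpair (sndB (fstB b)) (sndB (sndB b)))).
  split; rewrite !(fst_bpair, snd_bpair) // => i.
  by rewrite /bpair; case: ifP => _.
by rewrite /nat_cantor_split !(fst_bpair, snd_bpair) only0 !arg_code /= -n1 -n2 !bpair_fst_snd.
Qed.

Lemma nat_cantorS_choice_closed :
  closed_under_composition (@closed_choice (prodS natS cantorS)) /\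
  widempotent (@closed_choice (prodS natS cantorS)).
Proof.
apply: (@choice_criterion _ nat_cantor_advice (fun r => r) (fun r => bpair (only (fstB r 0)) (sndB r))
  always nat_cantor_split).
- exact: cmap_id.
- apply: cmap_pair; last by cmap.
  by apply: cmap_only; apply: (cmap_app (cmap_fst (cmap_id _))); rec.
- exact: cmap_always.
- exact: cmap_nat_cantor_split.
- move=> a [_ /cantor_advice_rep E]; exists (fstB a 0, fun n => sndB a n == 1).
  exact/prod_repP.
- move=> [n x]; exists (bpair (only n) (fun i => nat_of_bool (x i))); last first.
    by apply/prod_repP; rewrite fst_bpair snd_bpair; split => //; exact: cantor_named.
  by split; rewrite !(fst_bpair, snd_bpair) //; exact: cantor_rep_advice (cantor_named x).
- move=> r r' [n x] /prod_repP [[E1] E2] /prod_repP [[E1'] E2'] _; split => //.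
  by rewrite E1 E1' (cantor_rep_inj E2 E2').
- move=> r x /prod_repP [_ E] _; split; rewrite !(fst_bpair, snd_bpair) //.
  exact: cantor_rep_advice E.
- move=> a [/nat_adviceE n1 /cantor_advice_rep E]; exists a, (fstB a 0, fun n => sndB a n == 1).
  split => //; first exact/prod_repP.
  by rewrite -n1 bpair_fst_snd.
- exact: nat_cantor_split_pairs.
exact: nat_cantor_split_onto.
Qed.

Import Order.TTheory GRing.Theory Num.Theory.
Import numFieldNormedType.Exports.

(** * Digit expansions *)

(** With integer part [k] and digits [b], this is the integer
[c ^ i * (k + sum of b_j / c ^ j.+1 for j < i)]. *)

Definition digits (c k : nat) (b : nat -> nat) (i : nat) : nat :=
  natrec k (fun j r => c * r + b j) i.

Lemma digitsS c k b i : digits c k b i.+1 = c * digits c k b i + b i.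
Proof. by []. Qed.

Lemma digits_lower c k b j m : digits c k b j * c ^ m <= digits c k b (j + m).
Proof.
elim: m => [|m IH]; first by rewrite addn0 muln1.
by rewrite addnS digitsS expnS mulnCA (leq_trans _ (leq_addr _ _)) // leq_mul2l IH orbT.
Qed.

(** Digits at most 1 to the base [d.+1] add up to at most [1 / d] of a unit;
for [d = 3] this leaves room between different expansions. *)
Lemma digits_upper d k b j m : 0 < d -> (forall i, b i <= 1) ->
  d * digits d.+1 k b (j + m) < (d * digits d.+1 k b j + 1) * d.+1 ^ m.
Proof.
move=> d0 b1; elim: m => [|m IH]; first by rewrite addn0 muln1 addn1.
rewrite addnS digitsS expnS (mulnCA _ d.+1) mulnDr (mulnCA d d.+1).
have de : d * b (j + m) <= d by rewrite -[leqRHS]muln1 leq_mul2l b1 orbT.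
apply: (@leq_trans (d.+1 * (d * digits d.+1 k b (j + m)).+1)); last by rewrite leq_mul2l IH orbT.
by rewrite mulnS; lia.
Qed.

Local Open Scope ring_scope.

Section Digits.
Variables (F : realFieldType) (d k : nat) (b : nat -> nat).
Hypotheses (d0 : (0 < d)%N) (b1 : forall i, (b i <= 1)%N).
Let N := digits d.+1 k b.

Lemma digits_quot j m :
  0 <= (N (j + m))%:R / d.+1%:R ^+ (j + m) - (N j)%:R / d.+1%:R ^+ j :> F /\
  d%:R * ((N (j + m))%:R / d.+1%:R ^+ (j + m) - (N j)%:R / d.+1%:R ^+ j) < d.+1%:R ^- j :> F.
Proof.
have hl := digits_lower d.+1 k b j m; have hu := digits_upper k j m d0 b1.
have c0 i : 0 < d.+1%:R ^+ i :> F by rewrite exprn_gt0 // ltr0n.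
rewrite exprD.
have E : (N (j + m))%:R / (d.+1%:R ^+ j * d.+1%:R ^+ m) - (N j)%:R / d.+1%:R ^+ j =
  ((N (j + m))%:R - (N j)%:R * d.+1%:R ^+ m) / (d.+1%:R ^+ j * d.+1%:R ^+ m) :> F.
  by field; rewrite !lt0r_neq0.
rewrite E; split.
  apply: divr_ge0; last by rewrite mulr_ge0 // ltW.
  by rewrite subr_ge0 -natrX -natrM ler_nat.
rewrite mulrA ltr_pdivrMr ?mulr_gt0 // mulrA mulVf ?lt0r_neq0 // mul1r mulrBr ltrBlDr.
move: hu; rewrite -(ltr_nat F) mulnDl mul1n !(natrD, natrM, natrX) => hu.
by rewrite mulrA addrC.
Qed.
End Digits.

Lemma pow2_le (F : realFieldType) d j : (0 < d)%N -> d.+1%:R ^- j <= 2 ^- j :> F.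
Proof.
move=> d0; rewrite lef_pV2 ?posrE ?exprn_gt0 ?ltr0n //.
by rewrite lerXn2r ?nnegrE ?ler0n // ler_nat.
Qed.

(** * Names of reals *)

Definition rat_code (u v c : nat) : nat := ccons u (ccons v (ccons c 0)).

Lemma rat_of_code u v c : rat_of (rat_code u v c) = (u%:R - v%:R) / c.+1%:R.
Proof. by rewrite /rat_of /rat_code !arg_cconsS !arg_ccons0. Qed.

Section Reals.
Variable R : realType.

Lemma pow2_small (x : R) : (forall j, `|x| <= 2 ^- j) -> x = 0.
Proof.
move=> h; apply/eqP/contraT; rewrite -normr_gt0 => x0.
have /archi_boundP : 0 <= `|x|^-1 by rewrite invr_ge0.
set j := Num.bound _ => xj; have := h j.
rewrite -[`|x|]invrK lef_pV2 ?posrE ?invr_gt0 ?exprn_gt0 // => jx.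
have : (2 ^+ j : R) < j%:R by exact: le_lt_trans xj.
by rewrite -natrX ltr_nat ltnNge ltnW // ltn_expl.
Qed.

Definition cauchy_name (p : Baire) : Prop :=
  forall i j, (j < i)%N -> `|rat_of (p i) - rat_of (p j)| < 2 ^- j.

Lemma cvg_approx p (x : R) : cauchy_name p ->
  (fun n => ratr (rat_of (p n)) : R) @ \oo --> x ->
  forall j, `|ratr (rat_of (p j)) - x| <= 2 ^- j.
Proof.
move=> cauchy px j; apply/ler_addgt0Pr => e e0.
have /cvgrPdist_le /(_ e e0) [N _ HN] := px.
have /= Hn := HN (maxn N j.+1) (leq_maxl _ _).
have := cauchy (maxn N j.+1) j (leq_maxr _ _).
rewrite -(ltr_rat R) ratr_norm rmorphB /= fmorphV rmorphXn /= ratr_nat.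
move: (ratr (rat_of (p (maxn N j.+1)))) Hn => q Hn Hq.
rewrite distrC (le_trans (ler_distD q _ _)) // addrC lerD // ltW //.
Qed.

Lemma real_rep_approx p (x : R) : rep (realS R) p = Some x ->
  forall j, `|ratr (rat_of (p j)) - x| <= 2 ^- j.
Proof. by move=> /(@the_uniqueP R) [? ?]; exact: cvg_approx. Qed.

Lemma approx_unique (q : nat -> R) (x y : R) : (forall j, `|q j - x| <= 2 ^- j) ->
  (forall j, `|q j - y| <= 2 ^- j) -> y = x.
Proof.
move=> hx hy; apply/eqP; rewrite -subr_eq0; apply/eqP/pow2_small => j.
rewrite (le_trans (ler_distD (q j.+1) _ _)) // distrC.
have := lerD (hy j.+1) (hx j.+1).
have -> // : 2 ^- j.+1 + 2 ^- j.+1 = 2 ^- j :> R.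
by rewrite exprS invfM [in RHS](splitr (2 ^- j)) mulrC.
Qed.

Lemma real_repP p (x : R) : cauchy_name p ->
  (forall j, `|ratr (rat_of (p j)) - x| <= 2 ^- j) -> rep (realS R) p = Some x.
Proof.
move=> cauchy px; apply: the_unique_eq => [|y [_ /(cvg_approx cauchy) py]]; last first.
  exact: approx_unique px py.
split => //; apply/cvgrPdist_le => e e0.
have /archi_boundP : 0 <= e^-1 by rewrite invr_ge0 ltW.
set N := Num.bound _ => eN; exists N => // n /= Nn.
rewrite distrC (le_trans (px n)) // -[leRHS]invrK lef_pV2 ?posrE ?invr_gt0 ?exprn_gt0 //.
rewrite (le_trans (ltW eN)) // -natrX ler_nat (leq_trans Nn) //.
by rewrite ltnW // ltn_expl.
Qed.

(** [x] has the integers [N i] as truncated expansions to the base [d.+1], with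
a remainder of at most [1 / d] of a unit of the last place. *)
Definition tracks (d : nat) (x : R) (N : nat -> nat) : Prop :=
  forall i, (N i)%:R <= d.+1%:R ^+ i * x /\ d%:R * (d.+1%:R ^+ i * x - (N i)%:R) <= 1.

Lemma exists_tracked d k b : (0 < d)%N -> (forall i, (b i <= 1)%N) ->
  exists x, tracks d x (digits d.+1 k b).
Proof.
move=> d0 b1; set N := digits _ _ _.
pose a i : R := (N i)%:R / d.+1%:R ^+ i.
have c0 i : 0 < d.+1%:R ^+ i :> R by rewrite exprn_gt0 // ltr0n.
have d0R : 0 < d%:R :> R by rewrite ltr0n.
have bound i j : a i <= a j + d.+1%:R ^- j / d%:R.
  case: (leqP i j) => ij.
    have [+ _] := digits_quot R k d0 b1 i (j - i); rewrite subnKC // subr_ge0 => h.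
    by rewrite (le_trans h) // lerDl divr_ge0 ?invr_ge0 // ltW.
  have [_] := digits_quot R k d0 b1 j (i - j); rewrite subnKC 1?ltnW // => /ltW h.
  by rewrite -lerBlDl ler_pdivlMr // mulrC.
pose A := [set y | exists i, y = a i].
have A0 : A !=set0 by exists (a 0%N), 0%N.
have hA : has_sup A.
  by split => //; exists (a 0%N + d.+1%:R ^- 0 / d%:R) => _ [i ->]; exact: bound.
exists (sup A) => i; have lo : a i <= sup A by apply: sup_upper_bound => //; exists i.
have up : sup A <= a i + d.+1%:R ^- i / d%:R.
  by apply: ge_sup => // _ [j ->]; exact: bound.
split; first by rewrite mulrC -ler_pdivrMr.
have -> : (N i)%:R = d.+1%:R ^+ i * a i by rewrite /a mulrCA mulfV ?mulr1 // gt_eqF.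
rewrite -mulrBr mulrA -ler_pdivlMl ?mulr_gt0 // mulr1 lerBlDl (le_trans up) //.
by rewrite lerD2l invfM mulrC.
Qed.

(** The truncated expansions themselves, lowered by the integer [v], which gives
access to the negative numbers; they converge fast enough for a Cauchy name. *)
Definition digits_name (c k v : nat) (b : nat -> nat) : Baire :=
  fun i => rat_code (digits c k b i) (v * c ^ i) (c ^ i).-1.

Lemma rat_of_digits_name d k v b i :
  rat_of (digits_name d.+1 k v b i) = (digits d.+1 k b i)%:R / d.+1%:R ^+ i - v%:R.
Proof.
rewrite rat_of_code prednK ?expn_gt0 // natrM natrX mulrBl mulfK //.
by rewrite lt0r_neq0 // exprn_gt0 // ltr0n.
Qed.

Lemma digits_name_rep d k v b (x : R) : (0 < d)%N -> (forall i, (b i <= 1)%N) ->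
  tracks d (x + v%:R) (digits d.+1 k b) -> rep (realS R) (digits_name d.+1 k v b) = Some x.
Proof.
move=> d0 b1 tx.
have c0 (F : realFieldType) i : 0 < d.+1%:R ^+ i :> F by rewrite exprn_gt0 // ltr0n.
have shrink (F : realFieldType) j (y : F) : 0 <= y -> d%:R * y <= d.+1%:R ^- j -> y <= 2 ^- j.
  move=> y0 h; apply: le_trans (pow2_le F j d0); apply: le_trans h.
  by rewrite ler_peMl // ler1n.
apply: real_repP => [i j ji|j].
  have [h0 h1] := digits_quot rat k d0 b1 j (i - j); rewrite subnKC 1?ltnW // in h0 h1.
  have cancel (u v' w : rat) : u - w - (v' - w) = u - v' by ring.
  rewrite !rat_of_digits_name cancel ger0_norm //.
  apply: lt_le_trans (pow2_le rat j d0); apply: le_lt_trans h1.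
  by rewrite ler_peMl // ler1n.
rewrite rat_of_digits_name rmorphB fmorph_div rmorphXn /= !ratr_nat.
have [h0 h1] := tx j; have cj0 : 0 < d.+1%:R ^+ j :> R by exact: c0.
have cj : d.+1%:R ^+ j != 0 :> R by rewrite gt_eqF.
have E : x + v%:R - (digits d.+1 k b j)%:R / d.+1%:R ^+ j =
  (d.+1%:R ^+ j * (x + v%:R) - (digits d.+1 k b j)%:R) / d.+1%:R ^+ j.
  by field.
rewrite distrC opprB addrA E; have pos : 0 <= (d.+1%:R ^+ j * (x + v%:R) - (digits d.+1 k b j)%:R) / d.+1%:R ^+ j.
  by rewrite divr_ge0 ?subr_ge0 // ltW.
rewrite ger0_norm //; apply: shrink => //.
by rewrite mulrA ler_pdivrMr // mulVf.
Qed.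

(** * Reading digits from a Cauchy name *)

(** If [x] has an expansion to the base 4 with digits 0 and 1, then [4 ^ j * x]
lies less than 1/2 above an integer, the truncated expansion.  The rational at
place [2 * j + 2] of a name of [x] has an error of at most [4 ^ - j.+1], so
that the value [shifted], which is 1/4 above [4 ^ j] times this rational, has
that same integer as its integral part.  With [u], [v], [c] the parameters of
the rational, it is
[(4 ^ j.+1 * u + c.+1 - 4 ^ j.+1 * v) / (4 * c.+1)], computed by [round4] with
natural numbers only. *)
Definition scaled_upper (r : Baire) (j : nat) : nat :=
  (4 ^ j.+1 * arg (r j.*2.+2) 0 + (arg (r j.*2.+2) 2).+1)%N.
Definition scaled_lower (r : Baire) (j : nat) : nat := (4 ^ j.+1 * arg (r j.*2.+2) 1)%N.

Definition round4 (r : Baire) : Baire := fun j =>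
  ((scaled_upper r j - scaled_lower r j) %/ (4 * (arg (r j.*2.+2) 2).+1))%N.

Definition shifted (r : Baire) (j : nat) : R :=
  4%:R ^+ j * ratr (rat_of (r j.*2.+2)) + 4%:R^-1.

Lemma shiftedE r j : shifted r j =
  ((scaled_upper r j)%:R - (scaled_lower r j)%:R) / (4 * (arg (r j.*2.+2) 2).+1)%N%:R.
Proof.
rewrite /shifted /rat_of /scaled_upper /scaled_lower fmorph_div rmorphB /= !ratr_nat.
rewrite natrD !natrM natrX exprS.
have c0 : (arg (r j.*2.+2) 2).+1%:R != 0 :> R by rewrite pnatr_eq0.
by field; rewrite nat1r.
Qed.

Lemma shifted_ge0 r j : (0 <= shifted r j) = (scaled_lower r j <= scaled_upper r j)%N.
Proof.
by rewrite shiftedE pmulr_lge0 ?invr_gt0 ?ltr0n ?muln_gt0 // subr_ge0 ler_nat.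
Qed.

Lemma round4_floor r j : 0 <= shifted r j ->
  (round4 r j)%:R <= shifted r j < (round4 r j).+1%:R.
Proof.
rewrite shifted_ge0 => h; rewrite shiftedE -natrB // /round4.
set D := (4 * _)%N; have D0 : (0 < D)%N by rewrite muln_gt0.
move: (_ - _)%N => m.
by rewrite ler_pdivlMr ?ltr_pdivrMr ?ltr0n // -!natrM ler_nat ltr_nat leq_divM ltn_ceil.
Qed.

Lemma floor_unique (y : R) (m n : nat) : m%:R <= y < m.+1%:R -> n%:R <= y < n.+1%:R -> m = n.
Proof.
move=> /andP[a b] /andP[c d]; apply/eqP; rewrite eqn_leq.
by apply/andP; split; rewrite -ltnS -(ltr_nat R) ?(le_lt_trans a d) ?(le_lt_trans c b).
Qed.

Lemma shifted_close r (x : R) j : rep (realS R) r = Some x ->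
  4%:R ^+ j * x <= shifted r j <= 4%:R ^+ j * x + 2^-1.
Proof.
move=> /real_rep_approx /(_ j.*2.+2); rewrite /shifted.
have -> : 2 ^- j.*2.+2 = 4%:R^-1 / 4%:R ^+ j :> R.
  have -> : j.*2.+2 = (2 + 2 * j)%N by lia.
  by rewrite exprD exprM -!natrX invfM.
move: (ratr _) => q; have c0 : 0 < 4%:R ^+ j :> R by rewrite exprn_gt0 ?ltr0n.
rewrite ler_pdivlMr // -[X in _ * X](gtr0_norm c0) -normrM ler_norml mulrC => /andP[h1 h2].
rewrite mulrBr in h1 h2; move: (_ * q) (_ * x) h1 h2 => Q X h1 h2; lra.
Qed.

Lemma tracked_round r (x : R) N : rep (realS R) r = Some x -> tracks 3 x N ->
  forall j, 0 <= shifted r j /\ round4 r j = N j.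
Proof.
move=> rx tx j; have /andP[h1 h2] := shifted_close j rx; have [t1 t2] := tx j.
have N0 : 0 <= (N j)%:R :> R by rewrite ler0n.
have s0 : 0 <= shifted r j by apply: le_trans h1; exact: le_trans t1.
split => //; apply: (floor_unique (round4_floor s0)); rewrite -natr1.
by move: (_ * x) (N j)%:R (shifted r j) h1 h2 t1 t2 => X n y; lra.
Qed.

Definition decode4 (r : Baire) : Baire :=
  bpair (only (round4 r 0)) (fun j => nat_of_bool (odd (round4 r j.+1))).

Definition test4 (r : Baire) : Baire := fun j => nat_of_bool
  ((scaled_lower r j <= scaled_upper r j)%N &&
   (round4 r j.+1 == 4 * round4 r j + odd (round4 r j.+1))%N).

Lemma accepts_test4 r : accepts test4 r <-> forall j, 0 <= shifted r j /\
  round4 r j.+1 = (4 * round4 r j + odd (round4 r j.+1))%N.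
Proof.
split=> h j.
  by have := h j; rewrite /test4 eqb0 negbK shifted_ge0 => /andP[-> /eqP].
by rewrite /test4 eqb0 negbK -shifted_ge0; have [-> <-] := h j; rewrite eqxx.
Qed.

(** The digits read off satisfy the recurrence of an expansion, and the real
number with this expansion stays within one unit of every place from [x]. *)
Lemma accepted_tracked r (x : R) : rep (realS R) r = Some x -> accepts test4 r ->
  tracks 3 x (round4 r).
Proof.
move=> rx /accepts_test4 acc.
have [|x' tx'] := @exists_tracked 3 (round4 r 0) (fun j => nat_of_bool (odd (round4 r j.+1))) isT.
  by move=> i; case: odd.
have E : digits 4 (round4 r 0) (fun j => nat_of_bool (odd (round4 r j.+1))) = round4 r.
  apply/funext => j; elim: j => // j IH.
  by rewrite digitsS IH [RHS](acc j).2.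
rewrite E in tx'; suff -> : x = x' by [].
apply/eqP; rewrite -subr_eq0; apply/eqP/pow2_small => j.
apply: le_trans (@pow2_le R 3 j isT).
have c0 : 0 < 4%:R ^+ j :> R by rewrite exprn_gt0 ?ltr0n.
rewrite -[leRHS]mul1r ler_pdivlMr // -[X in _ * X](gtr0_norm c0) -normrM ler_norml mulrC mulrBr.
have /andP[h1 h2] := shifted_close j rx; have [t1 t2] := tx' j.
have /andP[h3 h4] := round4_floor (acc j).1; rewrite -natr1 in h4.
move: (_ * x) (_ * x') (round4 r j)%:R (shifted r j) h1 h2 h3 h4 t1 t2 => X X' n y; lra.
Qed.

(** To the base 2 expansions leave no gaps; the first component of the advice
codes the integer part as a difference. *)
Definition binary_name (a : Baire) : Baire :=
  digits_name 2 (arg (fstB a 0) 0) (arg (fstB a 0) 1) (sndB a).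

Lemma binary_name_rep (a : Baire) (x : R) : cantor_advice (sndB a) ->
  tracks 1 (x + (arg (fstB a 0) 1)%:R) (digits 2 (arg (fstB a 0) 0) (sndB a)) ->
  rep (realS R) (binary_name a) = Some x.
Proof. by move=> b1 tx; apply: digits_name_rep. Qed.

Lemma binary_name_onto (x : R) : exists2 a, nat_cantor_advice a & rep (realS R) (binary_name a) = Some x.
Proof.
(* A shift by [v] makes the number nonnegative. *)
pose v := Num.bound `|x|; pose y := x + v%:R.
have y0 : 0 <= y.
  have /ltW h : `|x| < v%:R by apply: archi_boundP.
  by rewrite -lerBlDr sub0r; apply: le_trans (lerNnormlW (lexx _)); rewrite lerN2.
pose N i := Num.trunc (2%:R ^+ i * y).
have NP i : (N i)%:R <= 2%:R ^+ i * y < (N i).+1%:R.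
  by apply: truncn_itv; rewrite mulr_ge0 ?exprn_ge0 ?ler0n.
have NS i : N i.+1 = (2 * N i + odd (N i.+1))%N.
  have /andP[a1 a2] := NP i; have /andP[b1 b2] := NP i.+1.
  rewrite exprS -mulrA in b1 b2.
  have c1 : (N i.+1 < 2 * (N i).+1)%N.
    by rewrite -(ltr_nat R) natrM (le_lt_trans b1) // ltr_pM2l.
  have c2 : (2 * N i < (N i.+1).+1)%N.
    by rewrite -(ltr_nat R) natrM (le_lt_trans _ b2) // ler_pM2l.
  lia.
have E : digits 2 (N 0) (fun j => nat_of_bool (odd (N j.+1))) = N.
  by apply/funext => j; elim: j => // j IH; rewrite digitsS IH [RHS]NS.
exists (bpair (only (CodeSeq.code [:: N 0; v])) (fun j => nat_of_bool (odd (N j.+1)))).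
  split; rewrite !(fst_bpair, snd_bpair) // => i.
  by case: odd.
apply: binary_name_rep; rewrite !(fst_bpair, snd_bpair) ?only0 ?arg_code /=.
  by move=> i; case: odd.
rewrite E => i; have /andP[a1 a2] := NP i; split => //.
by rewrite mul1r lerBlDl natr1 ltW.
Qed.

(** * Closed choice on the real line *)
Lemma cmap_digits_name D c k v (b : Baire -> Baire) : recursive D (fun p _ => k p) ->
  recursive D (fun p _ => v p) -> computable_map D b ->
  computable_map D (fun p => digits_name c (k p) (v p) (b p)).
Proof.
move=> hk hv hb; rewrite /computable_map /digits_name /rat_code.
apply: rec_ccons; last first.
  apply: rec_ccons; first by apply: rec_mul; [exact: hv|rec].
  by rec.
apply: rec_natrec; [exact: hk|rec|].
by apply: rec_add; [rec|apply: (cmap_app hb); rec].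
Qed.

Lemma cmap_binary_name D : computable_map D binary_name.
Proof.
have h : recursive D (fun p _ => fstB p 0).
  by apply: (cmap_app (cmap_fst (cmap_id _))); rec.
apply: cmap_digits_name; last by cmap.
- by apply: rec_arg; [exact: h|rec].
- by apply: rec_arg; [exact: h|rec].
Qed.

Lemma cmap_round4 D : computable_map D round4.
Proof. by rewrite /computable_map /round4 /scaled_upper /scaled_lower; rec. Qed.

Lemma cmap_decode4 D : computable_map D decode4.
Proof.
apply: cmap_pair.
  by apply: cmap_only; apply: (cmap_app (cmap_round4 D)); rec.
by apply: rec_odd; apply: (cmap_app (cmap_round4 D)); rec.
Qed.

Lemma cmap_test4 D : computable_map D test4.
Proof. by rewrite /computable_map /test4 /round4 /scaled_upper /scaled_lower; rec. Qed.

Lemma realS_choice_closed :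
  closed_under_composition (@closed_choice (realS R)) /\ widempotent (@closed_choice (realS R)).
Proof.
apply: (@choice_criterion (realS R) nat_cantor_advice binary_name decode4 test4 nat_cantor_split).
- exact: cmap_binary_name.
- exact: cmap_decode4.
- exact: cmap_test4.
- exact: cmap_nat_cantor_split.
- move=> a [_ b1].
  have [y ty] := exists_tracked (arg (fstB a 0) 0) (isT : 0 < 1)%N b1.
  exists (y - (arg (fstB a 0) 1)%:R); apply: binary_name_rep => //.
  by rewrite subrK.
- exact: binary_name_onto.
- move=> r r' x rx r'x acc; have tx := accepted_tracked rx acc.
  have E j := tracked_round r'x tx j; have Er : round4 r' = round4 r.
    by apply/funext => j; have [] := E j.
  split; last by rewrite /decode4 Er.
  apply/accepts_test4 => j; split; first by have [] := E j.
  by rewrite Er; have /accepts_test4 /(_ j) [] := acc.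
- move=> r x _ _; split; rewrite !(fst_bpair, snd_bpair) // => i.
  by case: odd.
- move=> a [/nat_adviceE n1 b1].
  have [x tx] := exists_tracked (fstB a 0) (isT : 0 < 3)%N b1.
  have rx : rep (realS R) (digits_name 4 (fstB a 0) 0 (sndB a)) = Some x.
    by apply: digits_name_rep => //; rewrite addr0.
  have T j := tracked_round rx tx j.
  have ob D j : nat_of_bool (odd (4 * D + sndB a j)) = sndB a j.
    by rewrite oddD oddM /=; have := b1 j; case: (sndB a j) => [|[]].
  exists (digits_name 4 (fstB a 0) 0 (sndB a)), x; split => //.
    apply/accepts_test4 => j; split; first by have [] := T j.
    by rewrite (T j).2 (T j.+1).2 digitsS ob.
  rewrite /decode4 (T 0%N).2 /= -n1 -[RHS]bpair_fst_snd; congr bpair.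
  by apply/funext => j; rewrite (T j.+1).2 digitsS ob.
- exact: nat_cantor_split_pairs.
exact: nat_cantor_split_onto.
Qed.
End Reals.

Theorem corollary7p6 (R : realType) :
  [/\ closed_under_composition (@closed_choice natS) /\ widempotent (@closed_choice natS),
      closed_under_composition (@closed_choice cantorS) /\ widempotent (@closed_choice cantorS),
      closed_under_composition (@closed_choice baireS) /\ widempotent (@closed_choice baireS),
      closed_under_composition (@closed_choice (prodS natS cantorS)) /\
        widempotent (@closed_choice (prodS natS cantorS))
    & closed_under_composition (@closed_choice (realS R)) /\
        widempotent (@closed_choice (realS R))].
Proof.
split; [exact: natS_choice_closed|exact: cantorS_choice_closed|exact: baireS_choice_closed| |].
- exact: nat_cantorS_choice_closed.
exact: realS_choice_closed.
Qed.
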